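(* Let $(X,\sigma_X)$ be a subshift with the weak specification property and let $\mathcal F=\{\log f_n\}_{n=1}^{\infty}$ be a sequence of continuous functions on $X$. Suppose that there exists an invariant Gibbs measure $\nu$ for $\mathcal F$, that is, $\nu\in M(X,\sigma_X)$ and there exist $P\in\mathbb R$, $C_0>0$ such that $$\frac1{C_0}\le\frac{\nu[x_1\dots x_n]}{e^{-nP}f_n(x)}\le C_0\quad\text{for every }x\in X,\ n\in\mathbb N.$$ For $x\in X$ put $$\underline r(x)=\liminf_{n\to\infty}\log\Big(\frac{\nu[x_1\dots x_n]}{\nu[x_2\dots x_n]}\Big)+P,\qquad \overline r(x)=\limsup_{n\to\infty}\log\Big(\frac{\nu[x_1\dots x_n]}{\nu[x_2\dots x_n]}\Big)+P .$$ Suppose that $\underline r(x)=\overline r(x)$ for every $x\in X$ and define $r(x):=\lim_{n\to\infty}\log\big(\nu[x_1\dots x_n]/\nu[x_2\dots x_n]\big)+P$. (i) If $\mathcal F$ is almost additive on $X$, then $r$ is bounded and Borel measurable on $X$ and $$\lim_{n\to\infty}\frac1n\int\log f_n\,d\mu=\lim_{n\to\infty}\frac1n\int\log\big(\nu[x_1\dots x_n]e^{nP}\big)\,d\mu(x)=\int r\,d\mu\qquad(a)$$ for every $\mu\in M(X,\sigma_X)$. Moreover the unique equilibrium state $\nu$ for $\mathcal F$ is the unique equilibrium state for $r$, and it is also the unique invariant Gibbs measure for $r$. (ii) If $\mathcal F$ is merely weakly almost additive, then $r$ is bounded and Borel measurable, and (a) holds for every $\mu\in M(X,\sigma_X)$.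 The measure $\nu$ is an equilibrium state for $r$ and is an invariant weak Gibbs measure for $r$.
   Context: A subshift $(X,\sigma_X)$ is a closed set $X\subseteq\{1,\dots,k\}^{\mathbb N}$ with $\sigma_X(X)\subseteq X$, where $(\sigma_X(x))_i=x_{i+1}$. $B_n(X)$ is the set of $n$-blocks appearing in points of $X$, $B_0(X)=\{\epsilon\}$ (empty word), $B(X)=\bigcup_{n\ge0}B_n(X)$, and $[x_1\dots x_n]=\{z\in X: z_i=x_i,\ 1\le i\le n\}$. $(X,\sigma_X)$ has the weak specification property if there is $p\in\mathbb N$ such that for all $u,v\in B(X)$ there are $0\le k\le p$ and $w\in B_k(X)$ with $uwv\in B(X)$. $M(X,\sigma_X)$ is the set of $\sigma_X$-invariant Borel probability measures on $X$; $S_ng=\sum_{i=0}^{n-1}g\circ\sigma_X^i$; $h_m(\sigma_X)$ is measure-theoretic entropy. A sequence of continuous functions $\mathcal F=\{\log f_n\}_{n\ge1}$ on $X$ means that each $f_n:X\to(0,\infty)$ is continuous. It is almost additive if there is $C>0$ with $e^{-C}f_n(x)f_m(\sigma_X^nx)\le f_{n+m}(x)\le e^{C}f_n(x)f_m(\sigma_X^nx)$ for all $x\in X$, $n,m\in\mathbb N$; weakly almost additive if there are $C_n>0$ with $\lim_{n\to\infty}C_n/n=0$ such that the same inequalities hold with $C$ replaced by $C_n$. $\mu\in M(X,\sigma_X)$ is an equilibrium state for $\mathcal F$ if it maximizes $m\mapsto h_m(\sigma_X)+\lim_{n\to\infty}\frac1n\int\log f_n\,dm$ over $M(X,\sigma_X)$.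 For a Borel measurable $g$ on $X$, $\mu\in M(X,\sigma_X)$ is an equilibrium state for $g$ if it maximizes $m\mapsto h_m(\sigma_X)+\int g\,dm$ over $M(X,\sigma_X)$; it is a weak Gibbs measure for $g$ if there are $P\in\mathbb R$ and $C_n>0$ with $\lim_{n\to\infty}\frac1n\log C_n=0$ such that $\frac1{C_n}\le\mu[x_1\dots x_n]/e^{-nP+(S_ng)(x)}\le C_n$ for all $x\in X$, $n\in\mathbb N$, and a Gibbs measure for $g$ if one can take $C_n=C$ for all $n$. It is known that an almost additive sequence with bounded variation (i.e. $\sup_n\sup\{f_n(x)/f_n(y):x_i=y_i,\,1\le i\le n\}<\infty$, which follows here from the Gibbs inequality) on a subshift with weak specification has a unique equilibrium state, which is its unique invariant Gibbs measure. *)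

(* Defs.v *)
From HB Require Import structures.
From mathcomp Require Import all_boot all_order all_algebra.
From mathcomp Require Import all_classical all_reals all_analysis.

Set Implicit Arguments.
Unset Strict Implicit.
Unset Printing Implicit Defensive.

Import Order.TTheory GRing.Theory Num.Theory.
Import numFieldNormedType.Exports.

Local Open Scope classical_set_scope.
Local Open Scope ring_scope.

(* Sequences are indexed from 0: the letter x_{i+1} of the usual notation
   x = x_1 x_2 ... is x i, and the alphabet {1, ..., k} is 'I_k. *)
Definition full_shift (k : nat) := {ptws nat -> discrete_topology 'I_k}.

Definition full_shift_map (k : nat) (x : full_shift k) : full_shift k :=
  fun i => x i.+1.

(* Non-emptiness is recorded because measurable spaces are pointed in this
   library; an empty X carries no probability measure anyway. *)
Record subshift (k : nat) : Type := Subshift {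
  carrier : set (full_shift k);
  carrier_closed : closed carrier;
  carrier_shift : @full_shift_map k @` carrier `<=` carrier;
  carrier_nonempty : carrier !=set0
}.

Definition shift_space (k : nat) (X : subshift k) : Type := set_type (carrier X).

Section shift_space_instances.
Variables (k : nat) (X : subshift k).

Lemma shift_space_inhabited : exists x : shift_space X, True.
Proof.
by have [x Xx] := carrier_nonempty X; exists (exist _ x (mem_set Xx)).
Qed.

HB.instance Definition _ := Topological.copy (shift_space X) (set_type (carrier X)).
HB.instance Definition _ :=
  isPointed.Build (shift_space X) (projT1 (cid shift_space_inhabited)).
(* Borel sigma-algebra of the subspace topology *)
HB.instance Definition _ :=
  Measurable.copy (shift_space X) (g_sigma_algebraType (@open (shift_space X))).

End shift_space_instances.

Section symbolic.
Variables (k : nat) (X : subshift k).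

Definition letter (x : shift_space X) (i : nat) : 'I_k := (set_val x : full_shift k) i.

Lemma full_shift_map_carrier (x : shift_space X) :
  full_shift_map (set_val x) \in carrier X.
Proof.
apply/mem_set/carrier_shift; exists (set_val x) => //.
exact: set_valP.
Qed.

Definition shift_map (x : shift_space X) : shift_space X :=
  exist (fun y => y \in carrier X) (full_shift_map (set_val x))
    (full_shift_map_carrier x).

Definition blocks (n : nat) : set (seq 'I_k) :=
  [set u | exists (x : shift_space X) (i : nat),
     u = mkseq (fun j => letter x (i + j)%N) n].

Definition language : set (seq 'I_k) := \bigcup_n blocks n.

Definition weak_specification : Prop :=
  exists p : nat, forall u v, language u -> language v ->
    exists (l : nat) (w : seq 'I_k),
      [/\ (l <= p)%N, blocks l w & language (u ++ w ++ v)].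

Definition cylinder (n : nat) (x : shift_space X) : set (shift_space X) :=
  [set z | forall i, (i < n)%N -> letter z i = letter x i].

End symbolic.

Section thermodynamics.
Variables (R : realType) (k : nat) (X : subshift k).
Implicit Types (m nu : probability (shift_space X) R) (f : nat -> shift_space X -> R)
  (g : shift_space X -> R).

Definition shift_invariant m : Prop :=
  forall A, measurable A -> m (@shift_map k X @^-1` A) = m A.

Definition birkhoff_sum g (n : nat) (x : shift_space X) : R :=
  \sum_(i < n) g (iter i (@shift_map k X) x).

(* A finite partition is given by its labelling map xi : X -> I; labels with
   an empty fibre contribute 0, as ln 0 = 0. *)
Definition partition_entropy m (I : finType) (xi : shift_space X -> I) : R :=
  - \sum_(a : I) fine (m (xi @^-1` [set a])) * ln (fine (m (xi @^-1` [set a]))).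

Definition itinerary (I : finType) (xi : shift_space X -> I) (n : nat)
    (x : shift_space X) : {ffun 'I_n -> I} :=
  [ffun i : 'I_n => xi (iter i (@shift_map k X) x)].

Definition entropy_of_partition m (I : finType) (xi : shift_space X -> I) : R :=
  limn (fun n => partition_entropy m (itinerary xi n) / n%:R).

Definition entropy m : \bar R :=
  ereal_sup [set h | exists (l : nat) (xi : shift_space X -> 'I_l),
    (forall a, measurable (xi @^-1` [set a])) /\
    h = (entropy_of_partition m xi)%:E].

(* A sequence {log f_n}_{n >= 1} is given by f; the value f 0 is irrelevant. *)
Definition continuous_sequence f : Prop :=
  forall n, (0 < n)%N -> continuous (f n) /\ (forall x, 0 < f n x).

Definition additive_up_to f (C : nat -> R) : Prop :=
  forall x n l, (0 < n)%N -> (0 < l)%N ->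
    expR (- C n) * (f n x * f l (iter n (@shift_map k X) x)) <= f (n + l)%N x /\
    f (n + l)%N x <= expR (C n) * (f n x * f l (iter n (@shift_map k X) x)).

Definition almost_additive f : Prop :=
  exists C : R, 0 < C /\ additive_up_to f (fun=> C).

Definition weakly_almost_additive f : Prop :=
  exists C : nat -> R,
    [/\ forall n, (0 < n)%N -> 0 < C n,
        C n / n%:R @[n --> \oo] --> 0
      & additive_up_to f C].

Definition mean_log_integral f m (n : nat) : \bar R :=
  ((n%:R^-1)%:E * \int[m]_x (ln (f n x))%:E)%E.

Definition equilibrium_state_seq f m : Prop :=
  shift_invariant m /\ forall m', shift_invariant m' ->
    (entropy m' + limn (mean_log_integral f m')
       <= entropy m + limn (mean_log_integral f m))%E.

Definition equilibrium_state g m : Prop :=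
  shift_invariant m /\ forall m', shift_invariant m' ->
    (entropy m' + \int[m']_x (g x)%:E <= entropy m + \int[m]_x (g x)%:E)%E.

Definition gibbs_bounds m (phi : nat -> shift_space X -> R) (P : R) (C : nat -> R)
    : Prop :=
  forall x n, (0 < n)%N ->
    (C n)^-1 <= fine (m (cylinder n x)) / (expR (- (n%:R * P)) * phi n x)
             <= C n.

Definition weak_gibbs_measure g m : Prop :=
  shift_invariant m /\ exists (P : R) (C : nat -> R),
    [/\ forall n, (0 < n)%N -> 0 < C n,
        ln (C n) / n%:R @[n --> \oo] --> 0
      & gibbs_bounds m (fun n x => expR (birkhoff_sum g n x)) P C].

Definition gibbs_measure g m : Prop :=
  shift_invariant m /\ exists P C : R,
    0 < C /\
    gibbs_bounds m (fun n x => expR (birkhoff_sum g n x)) P (fun=> C).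

(* Measures are functions on all subsets, including non-measurable ones, so
   uniqueness means agreement on Borel sets rather than Leibniz equality. *)
Definition unique_measure (Q : probability (shift_space X) R -> Prop) m : Prop :=
  Q m /\ forall m', Q m' -> forall A, measurable A -> m' A = m A.

Definition log_ratio m (x : shift_space X) (n : nat) : R :=
  ln (fine (m (cylinder n x)) / fine (m (cylinder n.-1 (shift_map x)))).

Definition r_lower m (P : R) (x : shift_space X) : \bar R :=
  (limn_einf (fun n => (log_ratio m x n)%:E) + P%:E)%E.

Definition r_upper m (P : R) (x : shift_space X) : \bar R :=
  (limn_esup (fun n => (log_ratio m x n)%:E) + P%:E)%E.

Definition r_limit m (P : R) (x : shift_space X) : R := limn (log_ratio m x) + P.

Definition bounded_borel g : Prop :=
  (exists M : R, forall x, `|g x| <= M) /\ measurable_fun setT g.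

Definition integral_formula f nu (P : R) g m : Prop :=
  mean_log_integral f m @ \oo --> (\int[m]_x (g x)%:E)%E /\
  mean_log_integral
    (fun n x => fine (nu (cylinder n x)) * expR (n%:R * P)) m @ \oo
    --> (\int[m]_x (g x)%:E)%E.

End thermodynamics.

(* Main.v *)
Require Import Defs.
From mathcomp Require Import all_boot all_order all_algebra.
From mathcomp Require Import all_classical all_reals all_analysis.
From mathcomp Require Import measurable_realfun.
From mathcomp Require Import ring lra zify.
Set Implicit Arguments.
Unset Strict Implicit.
Unset Printing Implicit Defensive.
Import Order.TTheory GRing.Theory Num.Theory.
Import numFieldNormedType.Exports.
Local Open Scope classical_set_scope.
Local Open Scope ring_scope.

(** Let T be the shift and phi_n x the logarithm of nu [x_1 ... x_n].  As nu is
a Gibbs measure, log f_n and phi_n + n P differ by at most log C0, so f may be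
replaced by the measures of cylinders.

The potential.  The Birkhoff sums of r telescope: S_n r x is the limit, as M
tends to infinity, of phi_(M+n) x - phi_M (T^n x) + n P.  Near-additivity of f
puts every term of this limit within C_n + 2 log C0 of log f_n x, hence so is
S_n r x ([birkhoff_sum_near]).  This single estimate shows that r is bounded
(take n = 1) and that nu satisfies the Gibbs inequality for r with constants
exp (C_n + 3 log C0).  Integrated against an invariant measure mu and divided by
n, it gives that the means (1/n) int log f_n dmu converge to int r dmu, so f and r
have the same equilibrium states.

The variational principle.  Let H_j be the entropy of an invariant measure m on
the words of length j.  Every finite Borel partition is almost a function of
finitely many letters, which gives entropy m <= H_j / j for all j
([entropy_le_ent_word]).  Since the relative entropy of m with respect to nu on
words of length j is nonnegative, H_j is at most the integral of - phi_j, that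
is j (P - int r dm) up to C_j + 3 log C0.  Hence entropy m + int r dm <= P, with
equality for m = nu, whose relative entropy with respect to itself is 0.

Uniqueness, for a constant C.  If m is an equilibrium state, then
H_j >= j (P - int r dm) for every j, so the relative entropies of m with respect
to nu on words are bounded uniformly in j; the same holds if m is a Gibbs
measure for r.  A bounded relative entropy forces m to be absolutely continuous
with respect to nu ([bounded_relative_entropy_dominated]).  Weak specification
and the lower bound nu [uwv] >= c nu [u] nu [v] make nu ergodic
([specification_mixing], [mixing_ergodic]), and an invariant probability that is
dominated by an ergodic one is equal to it ([dominated_ergodic_eq]). *)

(** * Cylinders and the Borel structure *)

Section cylinders.
Variables (k : nat) (X : subshift k).
Local Notation S := (shift_space X).
Local Notation T := (@shift_map k X).

(** These are the clopen sets that are unions of cylinders of length N.  Carrying N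
instead of a list of words makes complements, unions and refinements immediate. *)
Definition determined (N : nat) (U : set S) : Prop :=
  forall x y, cylinder N x y -> U x -> U y.

Lemma letter_shift_map (x : S) i : letter (T x) i = letter x i.+1.
Proof. by []. Qed.

Lemma letter_iter n (x : S) i : letter (iter n T x) i = letter x (n + i).
Proof.
by elim: n i => [|n IH] i //=; rewrite letter_shift_map IH addnS addSn.
Qed.

Lemma cylinder_sym n (x y : S) : cylinder n x y -> cylinder n y x.
Proof. by move=> xy i /xy. Qed.

Lemma cylinder_trans n (x y z : S) :
  cylinder n x y -> cylinder n y z -> cylinder n x z.
Proof. by move=> xy yz i lin; rewrite yz// xy. Qed.

Lemma eq_cylinder n (x y : S) : cylinder n x y -> cylinder n x = cylinder n y.
Proof.
move=> xy; apply/seteqP; split=> z; apply: cylinder_trans => //.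
exact: cylinder_sym.
Qed.

Lemma cylinder_determined n (x : S) : determined n (cylinder n x).
Proof. by move=> y z yz xy; exact: cylinder_trans xy yz. Qed.

Lemma determined_le n N U : (n <= N)%N -> determined n U -> determined N U.
Proof.
move=> nN dU x y xy; apply: dU => i lin; apply: xy; exact: leq_trans nN.
Qed.

Lemma determinedC n U : determined n U -> determined n (~` U).
Proof. by move=> dU x y xy Ux Uy; apply/Ux/(dU y) => //; exact: cylinder_sym. Qed.

Lemma determined_bigsetU n N (U : nat -> set S) :
  (forall i, (i < n)%N -> determined N (U i)) ->
  determined N (\big[setU/set0]_(i < n) U i).
Proof.
move=> dU x y xy; rewrite -!bigcup_mkord => -[i lin Ux].
by exists i => //; exact: (dU _ lin _ _ xy).
Qed.

(** The cylinders of x generate a filter that converges to x in every coordinate,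
hence in the product topology. *)
Lemma nbhs_cylinder (x : S) (U : set S) :
  nbhs x U -> exists N, cylinder N x `<=` U.
Proof.
rewrite nbhsE => -[V [[B oB BV] Vx] VU].
pose F := filter_from [set: nat] (fun N => [set y : full_shift k |
  forall i, (i < N)%N -> y i = (set_val x : full_shift k) i]).
have FF : Filter F.
  apply: filter_from_filter; first by exists 0%N.
  move=> i j _ _; exists (maxn i j) => // y yx; split=> l li; apply: yx.
    by rewrite leq_max li.
  by rewrite leq_max li orbT.
have cF : F --> (set_val x : full_shift k).
  apply/cvg_sup => i A /= [_ [[D oD <-] Dx DA]].
  exists i.+1 => // y yx; apply: DA; rewrite /= /proj yx//.
have [N _ NB] : F B.
  apply: cF; apply: open_nbhs_nbhs; split => //.
  by move: Vx; rewrite -BV.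
by exists N => y yx; apply: VU; rewrite -BV; exact: NB.
Qed.

Lemma open_letter i (a : 'I_k) : open [set x : S | letter x i = a].
Proof.
pose p (x : full_shift k) : discrete_topology 'I_k := x i.
have c : continuous p by exact: proj_continuous.
exists (p @^-1` [set a]) => //.
by apply: (proj1 (continuousP p) c); exact: discrete_open.
Qed.

Lemma nbhs_letters n (x : S) : nbhs x (cylinder n x).
Proof.
elim: n => [|n IH]; first by apply: filterE => y i.
have : nbhs x [set y : S | letter y n = letter x n].
  by apply: open_nbhs_nbhs; split => //; exact: open_letter.
apply: filterS2 IH => y xy yn i; rewrite ltnS leq_eqVlt => /orP[/eqP->//|].
exact: xy.
Qed.

Lemma open_cylindersP (U : set S) :
  (forall x, U x -> exists N, cylinder N x `<=` U) <-> open U.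
Proof.
split=> [cU|oU x Ux]; last by apply/nbhs_cylinder/open_nbhs_nbhs.
rewrite openE => x /cU[N NU]; apply: filterS NU _; exact: nbhs_letters.
Qed.

Lemma open_determined N (U : set S) : determined N U -> open U.
Proof.
move=> dU; apply/open_cylindersP => x Ux; exists N => y yx.
exact: dU yx Ux.
Qed.

Lemma measurable_open (U : set S) : open U -> measurable U.
Proof. by move=> oU; exact: sub_sigma_algebra. Qed.

Lemma measurable_determined N (U : set S) : determined N U -> measurable U.
Proof. by move=> dU; apply: measurable_open; exact: open_determined dU. Qed.

Lemma measurable_cylinder n (x : S) : measurable (cylinder n x).
Proof. exact: measurable_determined (@cylinder_determined n x). Qed.

Lemma measurable_shift_map : measurable_fun setT T.
Proof.
apply: (measurability (@open S)) => // _ [U oU <-]; rewrite setTI.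
have cU := proj2 (open_cylindersP U) oU.
apply: measurable_open; apply: (proj1 (open_cylindersP _)) => x /= /cU[N NU].
exists N.+1 => y yx.
apply: NU => i iN.
by rewrite !letter_shift_map yx.
Qed.

Lemma measurable_iter_shift n : measurable_fun setT (iter n T).
Proof.
elim: n => [|n IH]; first exact: measurable_id.
exact: measurableT_comp measurable_shift_map IH.
Qed.

Lemma measurable_preimage_iter n (A : set S) :
  measurable A -> measurable (iter n T @^-1` A).
Proof. by move=> mA; rewrite -[X in measurable X]setTI; exact: measurable_iter_shift. Qed.

Lemma measurable_fun_continuous (R : realType) (g : S -> R) :
  continuous g -> measurable_fun setT g.
Proof.
move=> /continuousP cg; apply: (measurability _ (RGenOpens.measurableE R)).
move=> _ [_ [a [b ->] <-]]; rewrite setTI.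
by apply: measurable_open; apply: cg; exact: interval_open.
Qed.

Lemma measurable_fun_letters (R : realType) N (g : S -> R) :
  (forall x y, cylinder N x y -> g x = g y) -> measurable_fun setT g.
Proof.
move=> gN _ B _; rewrite setTI; apply: (@measurable_determined N) => x y /gN.
by rewrite /= => ->.
Qed.

End cylinders.

(** * Approximation of Borel sets *)

Section real_probability.
Context d (U : measurableType d) (R : realType).
Variable m : probability U R.

Definition pr (A : set U) : R := fine (m A).

Lemma prE A : measurable A -> m A = (pr A)%:E.
Proof. by move=> mA; rewrite /pr fineK// fin_num_measure. Qed.

Lemma pr_ge0 A : 0 <= pr A.
Proof. by rewrite /pr fine_ge0. Qed.

Lemma pr0 : pr set0 = 0.
Proof. by rewrite /pr measure0. Qed.

Lemma prT : pr setT = 1.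
Proof. by rewrite /pr probability_setT. Qed.

Lemma pr_le A B : measurable A -> measurable B -> A `<=` B -> pr A <= pr B.
Proof.
by move=> mA mB AB; rewrite -lee_fin -!prE//; apply: le_measure; rewrite ?inE.
Qed.

Lemma pr_setU A B : measurable A -> measurable B -> pr (A `|` B) <= pr A + pr B.
Proof.
move=> mA mB; rewrite -lee_fin EFinD -!prE//; last exact: measurableU.
exact: measureU2.
Qed.

Lemma pr_bigsetU (I : finType) (A : I -> set U) (e : R) :
  (forall i, measurable (A i)) -> (forall i, pr (A i) <= e) ->
  pr (\big[setU/set0]_i A i) <= #|I|%:R * e.
Proof.
move=> mA Ae; have -> : #|I| = size (index_enum I).
  by rewrite cardT enumT [index_enum _]unlock.
elim: (index_enum I) => [|i s IH]; first by rewrite big_nil pr0 mul0r.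
rewrite big_cons /= -natr1 mulrDl mul1r addrC.
apply: le_trans (pr_setU _ _) (lerD _ _) => //; exact: bigsetU_measurable.
Qed.

Lemma pr_setDI A B : measurable A -> measurable B ->
  pr A = pr (A `\` B) + pr (A `&` B).
Proof.
move=> mA mB; apply: EFin_inj; rewrite EFinD -!prE//.
- exact: measureDI.
- exact: measurableI.
- exact: measurableD.
Qed.

Lemma prC A : measurable A -> pr (~` A) = 1 - pr A.
Proof.
move=> mA; apply: EFin_inj; rewrite EFinB -!prE//; last exact: measurableC.
exact: probability_setC.
Qed.

Lemma pr_le1 A : measurable A -> pr A <= 1.
Proof. by move=> mA; rewrite -lee_fin -prE//; exact: probability_le1. Qed.

Lemma pr_setY A B : measurable A -> measurable B ->
  pr A <= pr B + pr (A `+` B).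
Proof.
move=> mA mB; have mAB : measurable (A `+` B).
  by apply: measurableU; exact: measurableD.
apply: le_trans (pr_setU mB mAB); apply: pr_le => //; first exact: measurableU.
move=> x Ax; have [Bx|nBx] := pselect (B x); first by left.
by right; left.
Qed.

End real_probability.

Section approximation.
Variables (R : realType) (k : nat) (X : subshift k).
Local Notation S := (shift_space X).
Variables m1 m2 : probability S R.

(** One set V has to serve both measures: absolute continuity compares them on V. *)
Definition approximable (A : set S) := measurable A /\
  forall e : R, 0 < e -> exists N (V : set S),
    [/\ determined N V, pr m1 (A `+` V) < e & pr m2 (A `+` V) < e].

Lemma determined_approximable N (A : set S) : determined N A -> approximable A.
Proof.
move=> dA; split=> [|e e0]; first exact: measurable_determined dA.
by exists N, A; rewrite setYK !pr0.
Qed.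

Lemma approximableC (A : set S) : approximable A -> approximable (~` A).
Proof.
move=> [mA aA]; split=> [|e /aA[N [V [dV l1 l2]]]]; first exact: measurableC.
exists N, (~` V); have -> : ~` A `+` ~` V = A `+` V.
  by rewrite /setY !setDE !setCK setUC (setIC _ A) (setIC _ V).
by split => //; exact: determinedC.
Qed.

Let cvg_pr (m : probability S R) (A : nat -> set S) (e : R) : 0 < e ->
  (forall i, measurable (A i)) ->
  \forall n \near \oo,
    pr m ((\bigcup_i A i) `\` \big[setU/set0]_(i < n) A i) < e.
Proof.
move=> e0 mA; set B := \bigcup_i A i.
have mB : measurable B by exact: bigcupT_measurable.
pose F n := B `\` \big[setU/set0]_(i < n) A i.
have mF n : measurable (F n).
  by apply: measurableD => //; exact: bigsetU_measurable.
have F0 : \bigcap_n F n = set0.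
  rewrite -subset0 => x Fx; have [[i _ Aix] _] := Fx 0%N I.
  have [_] := Fx i.+1 I; apply; rewrite -bigcup_mkord; exists i => //=.
have : m \o F @ \oo --> m (\bigcap_n F n).
  apply: nonincreasing_cvg_mu => //.
  - by rewrite ltey_eq fin_num_measure.
  - by rewrite F0.
  - move=> i j ij; apply/subsetPset; apply: setDS; exact: (@subset_bigsetU _ A).
rewrite F0 measure0 => /fine_cvgP[_ /cvgr0_norm_lt/(_ e e0)].
by apply: filterS => n /= /ltr_normlW.
Unshelve. all: by end_near. Qed.

(** Continuity from above replaces the union by a finite one; the approximations of
its members are then regarded as determined by a common number of letters. *)
Lemma approximable_bigcup (A : nat -> set S) :
  (forall i, approximable (A i)) -> approximable (\bigcup_i A i).
Proof.
move=> aA; have mA i : measurable (A i) by case: (aA i).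
split=> [|e e0]; first exact: bigcupT_measurable.
have e20 : 0 < e / 2 by rewrite divr_gt0.
have [n [h1 h2]] : exists n,
    pr m1 ((\bigcup_i A i) `\` \big[setU/set0]_(i < n) A i) < e / 2 /\
    pr m2 ((\bigcup_i A i) `\` \big[setU/set0]_(i < n) A i) < e / 2.
  have : \forall n \near \oo,
    pr m1 ((\bigcup_i A i) `\` \big[setU/set0]_(i < n) A i) < e / 2 /\
    pr m2 ((\bigcup_i A i) `\` \big[setU/set0]_(i < n) A i) < e / 2.
    near=> n; split; near: n; exact: cvg_pr.
  by case=> n _ /(_ n (leqnn n)) ?; exists n.
(* n.+1 instead of n covers the case n = 0 *)
pose e' : R := e / 2 / n.+1%:R.
have e'0 : 0 < e' by rewrite divr_gt0.
have /choice[NV NVP] : forall i, exists NV : nat * set S,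
    [/\ determined NV.1 NV.2, pr m1 (A i `+` NV.2) < e'
      & pr m2 (A i `+` NV.2) < e'].
  by move=> i; have [_ /(_ e' e'0)[N [V ?]]] := aA i; exists (N, V).
pose N := (\max_(i < n) (NV i).1)%N.
pose V := \big[setU/set0]_(i < n) (NV i).2.
exists N, V.
have mV i : measurable (NV i).2.
  by have [/measurable_determined] := NVP i.
have key (m : probability S R) :
    pr m ((\bigcup_i A i) `\` \big[setU/set0]_(i < n) A i) < e / 2 ->
    (forall i, pr m (A i `+` (NV i).2) < e') ->
    pr m (\bigcup_i A i `+` V) < e.
  move=> h hi.
  set D := _ `\` _ in h; pose E := \big[setU/set0]_(i < n) (A i `+` (NV i).2).
  have mY i : measurable (A i `+` (NV i).2).
    by apply: measurableU; exact: measurableD.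
  have mE : measurable E by exact: bigsetU_measurable.
  have mD : measurable D.
    apply: measurableD; first exact: bigcupT_measurable.
    exact: bigsetU_measurable.
  apply: (@le_lt_trans _ _ (pr m (D `|` E))).
    apply: pr_le; last 1 first.
    - rewrite /D /E /V -!(bigcup_mkord n A).
      rewrite -(bigcup_mkord n (fun i => (NV i).2)).
      rewrite -(bigcup_mkord n (fun i => A i `+` (NV i).2)) => x.
      move=> [[[i _ Aix] nV]|[[i /= lin Vix] nA]].
        have [[j jn Ajx]|nAn] := pselect ((\bigcup_(i < n) A i) x).
          right; exists j => //; left; split => // Vj; apply: nV; by exists j.
        by left; split => //; exists i.
      right; exists i => //; right; split => // Aix; apply: nA; by exists i.
    - apply: measurableU; apply: measurableD.
      + exact: bigcupT_measurable.
      + exact: bigsetU_measurable.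
      + exact: bigsetU_measurable.
      + exact: bigcupT_measurable.
    - exact: measurableU.
  apply: le_lt_trans (pr_setU _ _ _) _ => //.
  suff : pr m E <= e / 2 by lra.
  have /le_trans : pr m E <= #|'I_n|%:R * e'.
    apply: (@pr_bigsetU _ _ _ _ _ (fun i : 'I_n => A i `+` (NV i).2)) => // i.
    exact: ltW.
  apply; rewrite card_ord mulrC /e' -(mulrA (e / 2)) ler_piMr//; first exact: ltW.
  by rewrite mulrC ler_pdivrMr// mul1r ler_nat.
split.
- apply: (@determined_bigsetU _ _ n N (fun i => (NV i).2)) => i lin.
  refine (@determined_le _ _ (NV i).1 _ _ _ _).
    exact: (@leq_bigmax _ (fun j : 'I_n => (NV j).1) (Ordinal lin)).
  by have [] := NVP i.
- by apply: key => // i; have [] := NVP i.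
- by apply: key => // i; have [] := NVP i.
Unshelve. all: by end_near. Qed.

(** Approximable sets form a sigma-algebra, and an open set is the union over N of
the set of points whose cylinder of length N it contains. *)
Lemma borel_approximable (A : set S) : measurable A -> approximable A.
Proof.
apply: smallest_sub; first split.
- exact: (@determined_approximable 0).
- by move=> B aB; rewrite setTD; exact: approximableC.
- exact: approximable_bigcup.
- move=> B oB.
  suff -> : B = \bigcup_N [set x | cylinder N x `<=` B].
    apply: approximable_bigcup => N; apply: (@determined_approximable N).
    by move=> x y /eq_cylinder xy /=; rewrite xy.
  apply/seteqP; split=> [x /(proj2 (open_cylindersP B) oB)[N NB]|x [N _]]; last exact.
  by exists N.
Qed.

End approximation.

(** * Entropy of finite labellings *)

Section finite_distributions.
Variables (R : realType) (I : finType).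
Implicit Types p q : I -> R.

(** This is ln t <= t - 1 at t = q a / p a. *)
Lemma gibbs_inequality p q :
  (forall a, 0 <= p a) -> (forall a, 0 <= q a) ->
  (forall a, 0 < p a -> 0 < q a) -> \sum_a q a <= \sum_a p a ->
  \sum_a p a * ln (q a) <= \sum_a p a * ln (p a).
Proof.
move=> p0 q0 pq qp1; rewrite -subr_ge0 -sumrB.
apply: (@le_trans _ _ (\sum_a (p a - q a))); first by rewrite sumrB subr_ge0.
apply: ler_sum => a _; rewrite -mulrBr.
have [pa0|pa0] := eqVneq (p a) 0; first by rewrite pa0 mul0r sub0r oppr_le0.
have pa : 0 < p a by rewrite lt_def pa0 p0.
have qa := pq _ pa.
have : ln (q a / p a) <= q a / p a - 1.
  rewrite -[X in ln X](addrNK 1) addrC; apply: le_ln1Dx.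
  by rewrite ltrBrDr addNr divr_gt0.
rewrite ln_div ?posrE// => h.
have : p a * (ln (q a) - ln (p a)) <= p a * (q a / p a - 1) by rewrite ler_pM2l.
rewrite [X in _ <= X -> _]mulrBr mulr1 mulrCA divff ?gt_eqF// mulr1.
by rewrite !mulrBr; lra.
Qed.

(** A law p at bounded relative entropy from q cannot charge an event that q almost
neglects.  The Gibbs inequality is applied to the reference that multiplies q by
1 / (2 t) on A and by 1 / 2 elsewhere, whose total mass is at most 1. *)
Lemma relative_entropy_event p q (A : {pred I}) (K t : R) :
  (forall a, 0 <= p a) -> (forall a, 0 <= q a) ->
  (forall a, 0 < p a -> 0 < q a) -> \sum_a p a = 1 -> \sum_a q a = 1 ->
  \sum_a p a * (ln (p a) - ln (q a)) <= K ->
  0 < t -> \sum_(a in A) q a <= t ->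
  (\sum_(a in A) p a) * ln (t^-1) <= K + ln 2.
Proof.
move=> p0 q0 pq p1 q1 DK t0 qAt.
pose c a : R := if a \in A then t^-1 / 2 else 2^-1.
have c0 a : 0 < c a.
  by rewrite /c; case: ifP => _; rewrite ?divr_gt0 ?invr_gt0.
have : \sum_a p a * ln (q a * c a) <= \sum_a p a * ln (p a).
  apply: gibbs_inequality => //.
  - by move=> a; rewrite mulr_ge0// ltW.
  - by move=> a /pq qa; rewrite mulr_gt0.
  - rewrite p1 (bigID (mem A))/=.
    apply: (@le_trans _ _ (1 / 2 + 1 / 2)); last lra.
    apply: lerD.
      rewrite (eq_bigr (fun a => q a * (t^-1 / 2))); last first.
        by move=> a aA; rewrite /c aA.
      rewrite -mulr_suml mulrA ler_pM2r ?invr_gt0//.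
      by rewrite ler_pdivrMr// mul1r.
    rewrite (eq_bigr (fun a => q a * 2^-1)); last first.
      by move=> a /negbTE aA; rewrite /c aA.
    rewrite -mulr_suml ler_pM2r ?invr_gt0// -q1 [leRHS](bigID (mem A))/=.
    by rewrite lerDr sumr_ge0.
rewrite (eq_bigr (fun a => p a * ln (q a) + p a * ln (c a))); last first.
  move=> a _; have [->|pa0] := eqVneq (p a) 0; first by rewrite !mul0r addr0.
  rewrite lnM ?posrE ?mulrDr//; apply: pq.
  by rewrite lt_def pa0 p0.
rewrite big_split/= => h.
have {DK}: \sum_a p a * ln (p a) - \sum_a p a * ln (q a) <= K.
  by apply: le_trans DK; rewrite -sumrB; apply: ler_sum => a _; rewrite mulrBr.
suff : (\sum_(a in A) p a) * ln t^-1 - ln 2 <= \sum_a p a * ln (c a) by lra.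
rewrite [leRHS](bigID (mem A))/=.
rewrite [X in _ <= X + _](eq_bigr (fun a => p a * (ln t^-1 - ln 2))); last first.
  by move=> a aA; rewrite /c aA ln_div// posrE ?invr_gt0.
rewrite [X in _ <= _ + X](eq_bigr (fun a => p a * - ln 2)); last first.
  by move=> a /negbTE aA; rewrite /c aA lnV// posrE.
rewrite -!mulr_suml.
have : \sum_(a in A) p a + \sum_(a | a \notin A) p a = 1.
  by rewrite -p1 [RHS](bigID (mem A)).
set x := \sum_(a in A) _; set y := \sum_(a | _) _ => xy.
have -> : y = 1 - x by lra.
by rewrite le_eqVlt; apply/orP; left; apply/eqP; ring.
Qed.

End finite_distributions.

Section labellings.
Context d (U : measurableType d) (R : realType).
Variable m : probability U R.

Definition measurable_label (I : finType) (xi : U -> I) : Prop :=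
  forall a, measurable (xi @^-1` [set a]).

Definition law (I : finType) (xi : U -> I) (a : I) : R := pr m (xi @^-1` [set a]).

Definition mean (I : finType) (xi : U -> I) (F : I -> R) : R :=
  \sum_a law xi a * F a.

(** Convertible to [partition_entropy]; written as a mean so that changes of
labelling apply to it. *)
Definition ent (I : finType) (xi : U -> I) : R := - mean xi (@ln R \o law xi).

Section one_labelling.
Variables (I : finType) (xi : U -> I).
Hypothesis mxi : measurable_label xi.

Lemma measurable_label_preimage (B : set I) : measurable (xi @^-1` B).
Proof.
have -> : xi @^-1` B = \bigcup_(a in B) xi @^-1` [set a].
  by apply/seteqP; split=> [x Bx|x [a Ba /= ->]//]; exists (xi x).
exact: fin_bigcup_measurable.
Qed.

Lemma pr_label (P : {pred I}) :
  pr m (xi @^-1` [set` P]) = \sum_(a in P) law xi a.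
Proof.
have -> : xi @^-1` [set` P] = \bigcup_(a in [set` P]) xi @^-1` [set a].
  by apply/seteqP; split=> [x Bx|x [a Ba /= ->]//]; exists (xi x).
rewrite /pr measure_fin_bigcup//; last first.
  by move=> a b _ _ [x [/= -> ->]].
rewrite -(@bigfs _ _ _ _ (index_enum I) P) ?index_enum_uniq//; last first.
  by move=> a _; rewrite mem_index_enum.
rewrite (eq_bigr (fun a => (law xi a)%:E)); last first.
  by move=> a _; exact: prE.
by rewrite sumEFin.
Qed.

Lemma law_ge0 a : 0 <= law xi a.
Proof. exact: pr_ge0. Qed.

Lemma law_sum1 : \sum_a law xi a = 1.
Proof.
rewrite -(prT m) -[setT](preimage_setT xi) -(pr_label predT).
by congr (pr m (xi @^-1` _)); apply/seteqP; split.
Qed.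

Lemma law_le1 a : law xi a <= 1.
Proof. exact: pr_le1. Qed.

Lemma law_gt0_ex a : 0 < law xi a -> exists x, xi x = a.
Proof.
move=> h; apply: contrapT => /forallNP nx; move: h.
rewrite /law; have -> : xi @^-1` [set a] = set0.
  by rewrite -subset0 => x /= /nx.
by rewrite pr0 ltxx.
Qed.

Section comp.
Variables (J : finType) (g : I -> J).

Lemma measurable_label_comp : measurable_label (g \o xi).
Proof. by move=> b; rewrite comp_preimage; exact: measurable_label_preimage. Qed.

Lemma law_comp b : law (g \o xi) b = \sum_(a | g a == b) law xi a.
Proof.
rewrite -pr_label /law comp_preimage; congr (pr m (xi @^-1` _)).
by apply/seteqP; split=> a /=; rewrite unfold_in/= => /eqP.
Qed.

Lemma mean_comp (F : J -> R) : mean (g \o xi) F = mean xi (F \o g).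
Proof.
rewrite /mean (partition_big g xpredT)//=; apply: eq_bigr => b _.
rewrite law_comp mulr_suml; apply: eq_bigr => a /eqP <- //.
Qed.

Lemma law_comp_ge a : law xi a <= law (g \o xi) (g a).
Proof.
rewrite law_comp (bigD1 a)//= lerDl sumr_ge0// => b _.
exact: law_ge0.
Qed.

(** Merging labels makes the atoms larger. *)
Lemma ent_comp : ent (g \o xi) <= ent xi.
Proof.
rewrite /ent mean_comp lerN2; apply: ler_sum => a _ /=.
have [->|a0] := eqVneq (law xi a) 0; first by rewrite !mul0r.
have a1 : 0 < law xi a by rewrite lt_def a0 law_ge0.
rewrite ler_pM2l// ler_ln ?posrE//; first exact: law_comp_ge.
exact: lt_le_trans (law_comp_ge a).
Qed.

End comp.

Lemma mean_le (F G : I -> R) : (forall a, 0 < law xi a -> F a <= G a) ->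
  mean xi F <= mean xi G.
Proof.
move=> FG; apply: ler_sum => a _.
have [->|a0] := eqVneq (law xi a) 0; first by rewrite !mul0r.
have a1 : 0 < law xi a by rewrite lt_def a0 law_ge0.
by rewrite ler_pM2l// FG.
Qed.

Lemma eq_mean (F G : I -> R) : (forall a, 0 < law xi a -> F a = G a) ->
  mean xi F = mean xi G.
Proof.
by move=> FG; apply/eqP; rewrite eq_le !mean_le// => a /FG ->.
Qed.

Lemma meanD (F G : I -> R) : mean xi (fun a => F a + G a) = mean xi F + mean xi G.
Proof. by rewrite /mean -big_split; apply: eq_bigr => a _; rewrite mulrDr. Qed.

Lemma meanN (F : I -> R) : mean xi (fun a => - F a) = - mean xi F.
Proof. by rewrite /mean -sumrN; apply: eq_bigr => a _; rewrite mulrN. Qed.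

Lemma mean_sum (J : finType) (F : J -> I -> R) :
  mean xi (fun a => \sum_j F j a) = \sum_j mean xi (F j).
Proof.
by rewrite /mean exchange_big; apply: eq_bigr => a _; rewrite mulr_sumr.
Qed.

Lemma ent_ge0 : 0 <= ent xi.
Proof.
rewrite oppr_ge0 sumr_le0// => a _; rewrite mulr_ge0_le0 ?law_ge0//.
exact/ln_le0/law_le1.
Qed.

(** Coding xi with lengths - ln (q a) costs on average at least its entropy.  All
upper bounds on entropies below come from a choice of q. *)
Lemma ent_le_mean (q : I -> R) : (forall a, 0 <= q a) ->
  (forall a, 0 < law xi a -> 0 < q a) -> \sum_a q a <= 1 ->
  ent xi <= - mean xi (@ln R \o q).
Proof.
move=> q0 pq q1; rewrite lerN2; apply: gibbs_inequality => //.
  exact: law_ge0.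
by rewrite law_sum1.
Qed.

End one_labelling.

Section joint.
Variables (I J : finType) (xi : U -> I) (zeta : U -> J).
Hypotheses (mxi : measurable_label xi) (mzeta : measurable_label zeta).

Lemma measurable_label_pair : measurable_label (fun x => (xi x, zeta x)).
Proof.
move=> [a b].
have -> : (fun x => (xi x, zeta x)) @^-1` [set (a, b)] =
    xi @^-1` [set a] `&` zeta @^-1` [set b].
  by apply/seteqP; split=> x /= [-> ->].
exact: measurableI.
Qed.

(** Code the pair with the product of the two laws. *)
Lemma ent_pair : ent (fun x => (xi x, zeta x)) <= ent xi + ent zeta.
Proof.
have mp := measurable_label_pair.
have l1 c : 0 < law (fun x => (xi x, zeta x)) c -> 0 < law xi c.1.
  by move=> /lt_le_trans; apply; exact: (law_comp_ge mp fst).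
have l2 c : 0 < law (fun x => (xi x, zeta x)) c -> 0 < law zeta c.2.
  by move=> /lt_le_trans; apply; exact: (law_comp_ge mp snd).
apply: le_trans (ent_le_mean mp (q := fun c => law xi c.1 * law zeta c.2) _ _ _) _.
- by move=> c; rewrite mulr_ge0// law_ge0.
- by move=> c c0; rewrite mulr_gt0 ?l1 ?l2.
- rewrite -(pair_big_dep xpredT (fun _ _ => true) (fun a b => law xi a * law zeta b))/=.
  rewrite (eq_bigr (law xi)) ?law_sum1// => a _.
  by rewrite -mulr_sumr law_sum1// mulr1.
rewrite (eq_mean (G := fun c => ln (law xi c.1) + ln (law zeta c.2))); last first.
  by move=> c c0 /=; rewrite lnM// posrE ?l1 ?l2.
rewrite meanD opprD /ent.
by rewrite -(mean_comp mp fst (@ln R \o law xi)) -(mean_comp mp snd (@ln R \o law zeta)).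
Qed.

End joint.

End labellings.

Section conditional_coding.
Context d (U : measurableType d) (R : realType).
Variable m : probability U R.
Variables (I J : finType) (n : nat) (xi : 'I_n -> U -> I) (Z : U -> J).
Hypotheses (mxi : forall i, measurable_label (xi i)) (mZ : measurable_label Z).

Definition tuple_label (x : U) : {ffun 'I_n -> I} := [ffun i => xi i x].

Lemma measurable_tuple_label : measurable_label tuple_label.
Proof.
move=> w; have -> : tuple_label @^-1` [set w] =
    \bigcap_(i in [set: 'I_n]) (xi i @^-1` [set w i]).
  apply/seteqP; split=> [x /= <- i _|x xw] /=; first by rewrite ffunE.
  by apply/ffunP => i; rewrite ffunE; exact: xw.
by apply: fin_bigcap_measurable => // i _; exact: mxi.
Qed.

Variables (h : 'I_n -> J -> I) (q : I -> I -> R).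
Hypotheses (q0 : forall a b, 0 < q a b) (q1 : forall b, \sum_a q a b = 1).

(** Code the tuple together with Z: first Z with its own law, then each entry of the
tuple with the conditional law q (. | h i Z).  This takes the place of the chain
rule and of the subadditivity of conditional entropy. *)
Lemma ent_tuple_label : ent m tuple_label <=
  ent m Z + \sum_i mean m (fun x => (xi i x, h i (Z x))) (fun c => - ln (q c.1 c.2)).
Proof.
have mj := measurable_label_pair measurable_tuple_label mZ.
set joint := fun x => _ in mj.
have lZ c : 0 < law m joint c -> 0 < law m Z c.2.
  by move=> /lt_le_trans; apply; exact: (law_comp_ge m mj snd).
have pq0 (w : {ffun 'I_n -> I}) z : 0 < \prod_i q (w i) (h i z).
  exact: prodr_gt0.
apply: le_trans (ent_comp m mj fst) _.
pose ref (c : {ffun 'I_n -> I} * J) := law m Z c.2 * \prod_i q (c.1 i) (h i c.2).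
apply: le_trans (ent_le_mean mj (q := ref) _ _ _) _.
- by move=> c; rewrite mulr_ge0 ?law_ge0// ltW.
- by move=> c c0; rewrite mulr_gt0 ?lZ.
- rewrite -(pair_big_dep xpredT (fun _ _ => true) (fun w z => ref (w, z)))/=.
  rewrite exchange_big/= -(law_sum1 m mZ); apply: ler_sum => z _.
  rewrite /ref/= -mulr_sumr -(bigA_distr_bigA (fun i a => q a (h i z)))/=.
  by rewrite big1 ?mulr1// => i _; exact: q1.
rewrite (eq_mean (G := fun c : {ffun 'I_n -> I} * J => ln (law m Z c.2) +
    \sum_i ln (q (c.1 i) (h i c.2)))); last first.
  move=> c c0 /=; rewrite lnM ?posrE ?lZ//; congr (_ + _).
  suff [] : 0 < \prod_i q (c.1 i) (h i c.2) /\
      ln (\prod_i q (c.1 i) (h i c.2)) = \sum_i ln (q (c.1 i) (h i c.2)) by [].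
  apply: (big_ind2 (fun x y => 0 < x /\ ln x = y)) => [|x1 y1 x2 y2 [? <-] [? <-]|//].
    by rewrite ln1.
  by rewrite mulr_gt0// lnM// posrE.
rewrite meanD opprD /ent -(mean_comp m mj snd (@ln R \o law m Z)) lerD2l.
rewrite mean_sum -sumrN; apply: ler_sum => i _; rewrite -meanN.
pose g (c : {ffun 'I_n -> I} * J) := (c.1 i, h i c.2).
have -> : (fun x => (xi i x, h i (Z x))) = g \o joint.
  by apply/funext => x; rewrite /g /joint /= ffunE.
by rewrite (mean_comp m mj g).
Qed.

End conditional_coding.

Section fano.
Context d (U : measurableType d) (R : realType).
Variable m : probability U R.
Variables (I : finType).

(** If eta predicts xi up to a small probability of error, then xi is cheap to code
given eta.  The conditional law bets 1 - e on the prediction and spreads e over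
all labels. *)
Lemma fano_inequality (xi eta : U -> I) (e : R) : 0 < e < 1 ->
  measurable_label xi -> measurable_label eta ->
  mean m (fun x => (xi x, eta x))
    (fun c => - ln ((1 - e) * (c.1 == c.2)%:R + e / #|I|%:R)) <=
  - ln (1 - e) + pr m [set x | xi x <> eta x] * ln (#|I|%:R / e).
Proof.
move=> /andP[e0 e1] mxi meta.
have mp := measurable_label_pair mxi meta.
have [x0 _] : exists x : I, True.
  apply: contrapT => /forallNP nI; have := law_sum1 m mxi.
  rewrite big1 => [/eqP|a _]; first by rewrite eq_sym oner_eq0.
  by have := nI a; tauto.
have cI : 0 < #|I|%:R :> R by rewrite ltr0n; apply/card_gt0P; exists x0.
have cI1 : 1 <= #|I|%:R :> R by rewrite ler1n; apply/card_gt0P; exists x0.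
have eI : 0 < e / #|I|%:R by rewrite divr_gt0.
have -> : pr m [set x | xi x <> eta x] * ln (#|I|%:R / e) =
    mean m (fun x => (xi x, eta x)) (fun c => (c.1 != c.2)%:R * ln (#|I|%:R / e)).
  have -> : [set x | xi x <> eta x] = (fun x => (xi x, eta x)) @^-1`
      [set` [pred c : I * I | c.1 != c.2]].
    by apply/seteqP; split=> x /= /eqP.
  rewrite pr_label// mulr_suml big_mkcond/=; apply: eq_bigr => c _.
  by rewrite inE; case: ifP; rewrite ?mul1r ?mul0r ?mulr0.
have -> : - ln (1 - e) = mean m (fun x => (xi x, eta x)) (fun=> - ln (1 - e)).
  by rewrite /mean -mulr_suml law_sum1// mul1r.
rewrite -meanD; apply: mean_le => -[a b] _ /=.
case: eqP => [_|_]/=.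
  rewrite mulr1 mul0r addr0 lerN2 ler_ln ?posrE; lra.
rewrite mulr0 add0r mul1r -[e / _]invf_div lnV ?posrE ?divr_gt0// opprK.
by rewrite lerDr oppr_ge0; apply: ln_le0; lra.
Qed.

End fano.

(** * Entropy of a shift-invariant measure *)

Section words.
Variables (R : realType) (k : nat) (X : subshift k).
Local Notation S := (shift_space X).
Local Notation T := (@shift_map k X).

Definition word (n : nat) : S -> {ffun 'I_n -> 'I_k} :=
  itinerary (fun x : S => letter x 0) n.

Lemma wordE n x i : word n x i = letter x i.
Proof. by rewrite ffunE letter_iter addn0. Qed.

Lemma wordP n x y : word n x = word n y <-> cylinder n x y.
Proof.
split=> [xy i lin|xy].
  by have /ffunP/(_ (Ordinal lin)) := xy; rewrite !wordE /= => ->.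
by apply/ffunP => i; rewrite !wordE xy.
Qed.

Lemma preimage_word n x : word n @^-1` [set word n x] = cylinder n x.
Proof.
apply/seteqP; split=> y /=; first by move=> /esym/wordP.
by move=> /wordP.
Qed.

Lemma measurable_word n : measurable_label (word n).
Proof.
move=> w; apply: (@measurable_determined _ _ n) => x y /wordP xy.
by rewrite /= xy.
Qed.

Variable m : probability S R.
Hypothesis minv : shift_invariant m.

Lemma law_word n x : law m (word n) (word n x) = pr m (cylinder n x).
Proof. by rewrite /law preimage_word. Qed.

Lemma pr_iter n A : measurable A -> pr m (iter n T @^-1` A) = pr m A.
Proof.
move=> mA; elim: n => [//|n IH]; rewrite -IH /pr -(minv (measurable_preimage_iter n mA)).
by congr (fine (m _)); apply/seteqP; split=> x; rewrite /= -iterSr.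
Qed.

Lemma law_iter (I : finType) (xi : S -> I) n : measurable_label xi ->
  law m (xi \o iter n T) = law m xi.
Proof. by move=> mxi; apply/funext => a; rewrite /law comp_preimage pr_iter. Qed.

Lemma measurable_label_iter (I : finType) (xi : S -> I) n : measurable_label xi ->
  measurable_label (xi \o iter n T).
Proof. by move=> mxi a; rewrite comp_preimage; exact: measurable_preimage_iter. Qed.

Lemma ent_word_le n N : (n <= N)%N -> ent m (word n) <= ent m (word N).
Proof.
move=> nN; have := ent_comp m (@measurable_word N)
  (fun z => [ffun i : 'I_n => z (widen_ord nN i)]).
congr (ent m _ <= _); apply/funext => x; apply/ffunP => i.
by rewrite /= ffunE !wordE.
Qed.

Lemma ent_word_add a b : ent m (word (a + b)) <= ent m (word a) + ent m (word b).
Proof.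
have mb := @measurable_label_iter _ _ a (@measurable_word b).
have ma := @measurable_word a.
have -> : ent m (word b) = ent m (word b \o iter a T).
  by rewrite /ent /mean law_iter//; exact: measurable_word.
apply: le_trans (ent_pair m ma mb).
pose g (c : {ffun 'I_a -> 'I_k} * {ffun 'I_b -> 'I_k}) : {ffun 'I_(a + b) -> 'I_k} :=
  [ffun i => match fintype.split i with inl j => c.1 j | inr j => c.2 j end].
have := ent_comp m (measurable_label_pair ma mb) g.
congr (ent m _ <= _); apply/funext => x; apply/ffunP => i.
rewrite /= ffunE wordE; case: (splitP i) => j ->; rewrite !wordE//.
by rewrite letter_iter.
Qed.

Lemma ent_word_mul s j : ent m (word (s * j)) <= s%:R * ent m (word j).
Proof.
elim: s => [|s IH].
  rewrite mul0n mul0r -oppr_ge0 /ent opprK /mean sumr_ge0// => w _.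
  have lw : law m (word 0) w = 1.
    rewrite /law -(prT m); congr pr; apply/seteqP; split=> // x _ /=.
    by apply/ffunP => -[].
  by rewrite /= lw ln1 mulr0.
rewrite mulSn -natr1 mulrDl mul1r addrC; apply: le_trans (ent_word_add _ _) _.
by rewrite lerD2l.
Qed.

(** Approximate each fibre of xi by a set determined by finitely many letters, and
decode a point by one of the sets that contain it.  A wrong guess puts the point
in the symmetric difference of some fibre and its approximation. *)
Lemma label_approximation (I : finType) (xi : S -> I) (e : R) : 0 < e ->
  measurable_label xi -> exists N (h : {ffun 'I_N -> 'I_k} -> I),
    pr m [set x | xi x <> h (word N x)] < e.
Proof.
move=> e0 mxi; pose e' : R := e / #|I|.+1%:R.
have e'0 : 0 < e' by rewrite divr_gt0.
have /choice[NV NVP] : forall a, exists NV : nat * set S,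
    determined NV.1 NV.2 /\ pr m ((xi @^-1` [set a]) `+` NV.2) < e'.
  move=> a; have [_ /(_ e' e'0)[N [V [? ?]]]] := borel_approximable m m (mxi a).
  by exists (N, V).
pose N := (\max_a (NV a).1)%N.
pose eta x := odflt (xi point) [pick a | `[< (NV a).2 x >]].
have dN a : determined N (NV a).2.
  apply: (@determined_le _ _ (NV a).1); last by case: (NVP a).
  exact: (@leq_bigmax _ (fun a => (NV a).1)).
have etaN x y : cylinder N x y -> eta x = eta y.
  move=> xy; rewrite /eta; congr odflt; apply: eq_pick => a.
  apply/asbool_equiv_eq; split; first exact: dN.
  by apply: dN; exact: cylinder_sym.
have [h hP] : exists h : {ffun 'I_N -> 'I_k} -> I, forall x, eta x = h (word N x).
  have /choice[h hP] : forall w, exists a, forall x, word N x = w -> eta x = a.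
    move=> w; have [[x <-]|nw] := pselect (exists x, word N x = w).
      by exists (eta x) => y /wordP/etaN.
    by exists (xi point) => x xw; exfalso; apply: nw; exists x.
  by exists h => x; exact: hP.
exists N, h.
have mV a : measurable (NV a).2 by exact: measurable_determined (dN a).
have mY a : measurable ((xi @^-1` [set a]) `+` (NV a).2).
  by apply: measurableU; exact: measurableD.
have mE : measurable (\big[setU/set0]_a ((xi @^-1` [set a]) `+` (NV a).2)).
  exact: bigsetU_measurable.
apply: (@le_lt_trans _ _ (pr m (\big[setU/set0]_a ((xi @^-1` [set a]) `+` (NV a).2)))).
  apply: pr_le => //.
    have -> : [set x | xi x <> h (word N x)] =
      (fun x => (xi x, h (word N x))) @^-1` [set c | c.1 <> c.2] by [].
    apply: measurable_label_preimage; apply: measurable_label_pair => //.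
    exact: (measurable_label_comp (@measurable_word N)).
  move=> x /=; rewrite -hP; apply: contra_notP => nx.
  have {}nx a : ~ ((xi @^-1` [set a]) `+` (NV a).2) x.
    by move=> ax; apply: nx; rewrite (bigD1 a)//=; left.
  rewrite /eta; case: pickP => [a /asboolP ax|/(_ (xi x))/asboolP nV] /=.
    by apply: contrapT => xa; apply: (nx a); right; split => // /esym.
  by exfalso; apply: (nx (xi x)); left.
apply: le_lt_trans (pr_bigsetU (m := m) (e := e') mY _) _.
  by move=> a; apply: ltW; case: (NVP a).
rewrite mulrC /e' -mulrA gtr_pMr//.
by rewrite mulrC ltr_pdivrMr// mul1r ltr_nat.
Qed.

(** Conditionally on n + N letters, each of the n labels of an itinerary is almost
known, at a cost of - ln (1 - e) + kappa per label. *)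
Lemma ent_itinerary_le l (xi : S -> 'I_l) (e kappa : R) : 0 < e < 1 ->
  0 < kappa -> measurable_label xi ->
  exists N, forall n, ent m (itinerary xi n) <=
    ent m (word (n + N)) + n%:R * (- ln (1 - e) + kappa).
Proof.
move=> e01 kappa0 mxi.
have /andP[e0 e1] := e01.
have l0 : (0 < l)%N by case: (xi point) => i; exact: leq_ltn_trans.
have l0R : 0 < l%:R :> R by rewrite ltr0n.
have l1 : 1 <= l%:R :> R by rewrite ler1n.
(* the logarithm is nonnegative and 1 is added to make c positive *)
pose c : R := ln (l%:R / e) + 1.
have lc : 0 <= ln (l%:R / e).
  by apply: ln_ge0; rewrite ler_pdivlMr// mul1r; lra.
have c0 : 0 < c by rewrite /c; lra.
have [N [h hP]] := label_approximation (divr_gt0 kappa0 c0) mxi.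
exists N => n.
have sub_lt (i : 'I_n) (t : 'I_N) : (i + t < n + N)%N.
  by have := ltn_ord i; have := ltn_ord t; lia.
pose sub (i : 'I_n) (z : {ffun 'I_(n + N) -> 'I_k}) : {ffun 'I_N -> 'I_k} :=
  [ffun t => z (Ordinal (sub_lt i t))].
have subE i x : sub i (word (n + N) x) = word N (iter i T x).
  by apply/ffunP => t; rewrite ffunE !wordE letter_iter.
pose q (a b : 'I_l) : R := (1 - e) * (a == b)%:R + e / #|'I_l|%:R.
have q0 a b : 0 < q a b.
  by rewrite /q card_ord ltr_wpDl ?divr_gt0// mulr_ge0// subr_ge0 ltW.
have q1 b : \sum_a q a b = 1.
  rewrite /q big_split/= -mulr_sumr sumr_const -[X in _ + X]mulr_natr.
  rewrite mulfVK ?card_ord ?gt_eqF//.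
  rewrite (bigD1 b)//= eqxx big1; last by move=> a /negbTE ->.
  by rewrite addr0 mulr1 subrK.
apply: le_trans (ent_tuple_label m (fun i => measurable_label_iter i mxi)
  (@measurable_word (n + N)) (fun i z => h (sub i z)) q0 q1) _.
rewrite lerD2l.
have -> : n%:R * (- ln (1 - e) + kappa) = \sum_(i < n) (- ln (1 - e) + kappa).
  by rewrite sumr_const card_ord mulr_natl.
apply: ler_sum => i _.
pose eta x := h (word N x).
have meta : measurable_label eta.
  exact: (measurable_label_comp (@measurable_word N)).
have -> : (fun x => ((xi \o iter i T) x, h (sub i (word (n + N) x)))) =
    (fun x => (xi x, eta x)) \o iter i T.
  by apply/funext => x; rewrite /= subE.
rewrite /mean law_iter; last exact: measurable_label_pair.
apply: le_trans (fano_inequality m e01 mxi meta) _.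
rewrite lerD2l card_ord.
apply: (@le_trans _ _ (kappa / c * c)); last by rewrite divfK ?gt_eqF.
apply: ler_pM => //; first exact: pr_ge0.
  exact: ltW.
by rewrite /c lerDl.
Qed.

(** The words of length n + N in [ent_itinerary_le] are cut into blocks of length j,
each of which costs at most the entropy of the words of length j. *)
Lemma entropy_of_partition_le l (xi : S -> 'I_l) j : (0 < j)%N ->
  measurable_label xi -> entropy_of_partition m xi <= ent m (word j) / j%:R.
Proof.
move=> j0 mxi; rewrite /entropy_of_partition; set u := fun n => _.
have H0 : 0 <= ent m (word j) by exact: ent_ge0 (@measurable_word j).
have Hj0 : 0 <= ent m (word j) / j%:R by rewrite divr_ge0.
(* a divergent sequence has limit 0 by convention, which the bound covers *)
have [cu|ncu] := pselect (cvgn u); last first.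
  by rewrite dvgP.
apply/ler_addgt0Pr => e e0.
(* chosen so that - ln (1 - e1) = e / 3 *)
pose e1 : R := 1 - expR (- (e / 3)).
have e1P : 0 < e1 < 1.
  rewrite /e1 subr_gt0 expR_lt1 oppr_lt0 divr_gt0//=.
  by rewrite ltrBlDr ltrDl expR_gt0.
have e30 : 0 < e / 3 by rewrite divr_gt0.
have [N HN] := ent_itinerary_le e1P e30 mxi.
apply: limr_le => //.
set H := ent m (word j) in H0 Hj0 *.
pose K := (N%:R / j%:R + 1) * H.
have jR : 0 < j%:R :> R by rewrite ltr0n.
have K0 : 0 <= K by rewrite mulr_ge0// addr_ge0// divr_ge0.
near=> n.
have n0 : (0 < n)%N by near: n; exact: nbhs_infty_gt.
have nR : 0 < n%:R :> R by rewrite ltr0n.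
have nK : K / (e / 3) <= n%:R by near: n; exact: nbhs_infty_ger.
rewrite /u ler_pdivrMr//.
have -> : partition_entropy m (itinerary xi n) = ent m (itinerary xi n) by [].
apply: le_trans (HN n) _.
have -> : - ln (1 - e1) = e / 3 by rewrite /e1 subKr expRK opprK.
have h1 : ent m (word (n + N)) <= ((n + N) %/ j).+1%:R * H.
  apply: le_trans (ent_word_mul _ _); apply: ent_word_le.
  by rewrite ltnW// ltn_ceil.
have h2 : ((n + N) %/ j).+1%:R <= (n%:R + N%:R) / j%:R + 1 :> R.
  by rewrite -natr1 lerD2r ler_pdivlMr// -natrM -natrD ler_nat leq_trunc_div.
have h3 : ((n + N) %/ j).+1%:R * H <= ((n%:R + N%:R) / j%:R + 1) * H.
  by rewrite ler_wpM2r.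
have h4 : ((n%:R + N%:R) / j%:R + 1) * H = n%:R * (H / j%:R) + K.
  by rewrite /K; ring.
have h5 : K <= n%:R * (e / 3) by rewrite -ler_pdivrMr.
rewrite [leRHS]mulrC [leRHS]mulrDr.
have -> : n%:R * (e / 3 + e / 3) = n%:R * e - n%:R * (e / 3).
  by rewrite -mulrBr; congr (_ * _); lra.
lra.
Unshelve. all: by end_near. Qed.

Theorem entropy_le_ent_word j : (0 < j)%N ->
  (entropy m <= (ent m (word j) / j%:R)%:E)%E.
Proof.
move=> j0; apply: ge_ereal_sup => _ [l [xi [mxi ->]]].
by rewrite lee_fin; exact: entropy_of_partition_le.
Qed.

End words.

(** * Ergodicity and absolute continuity *)

Section ergodic_uniqueness.
Context d (U : measurableType d) (R : realType).

Lemma cvg_pr_bigcup (m : probability U R) (F : nat -> set U) :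
  (forall n, measurable (F n)) -> nondecreasing_seq F ->
  pr m (F n) @[n --> \oo] --> pr m (\bigcup_n F n).
Proof.
move=> mF ndF; have mU : measurable (\bigcup_n F n) by exact: bigcupT_measurable.
suff /fine_cvgP[] : m \o F @ \oo --> (pr m (\bigcup_n F n))%:E by [].
by rewrite -prE//; exact: nondecreasing_cvg_mu.
Qed.

Lemma cvg_pr_bigcap (m : probability U R) (F : nat -> set U) :
  (forall n, measurable (F n)) -> nonincreasing_seq F ->
  pr m (F n) @[n --> \oo] --> pr m (\bigcap_n F n).
Proof.
move=> mF niF; have mI : measurable (\bigcap_n F n) by exact: bigcapT_measurable.
suff /fine_cvgP[] : m \o F @ \oo --> (pr m (\bigcap_n F n))%:E by [].
rewrite -prE//; apply: nonincreasing_cvg_mu => //.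
by rewrite ltey_eq fin_num_measure.
Qed.

Lemma pr_setUI (m : probability U R) A B : measurable A -> measurable B ->
  pr m (A `|` B) + pr m (A `&` B) = pr m A + pr m B.
Proof.
move=> mA mB; have mU : measurable (A `|` B) by exact: measurableU.
rewrite (pr_setDI m mU mB) (pr_setDI m mA mB).
have -> : (A `|` B) `\` B = A `\` B by rewrite setDUl setDv setU0.
have -> : (A `|` B) `&` B = B by rewrite setIUl setIid setUidr//; exact: subIsetr.
by ring.
Qed.

(** Let Q be the positive part of a Hahn decomposition of m - nu, so that Q maximizes
m - nu.  By invariance the iterated preimages of Q are maximizers too.  Maximizers
are stable under unions and monotone limits, so the upper limit E of these
preimages is a maximizer, and it is strictly invariant.  By ergodicity nu E or
nu (~` E) is 0, and by domination m - nu vanishes on E.  The maximum is thus 0;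
so m <= nu on all Borel sets, and equality follows by passing to complements. *)
Lemma dominated_ergodic_eq (T : U -> U) (m nu : probability U R) :
  measurable_fun setT T ->
  (forall A, measurable A -> pr m (T @^-1` A) = pr m A) ->
  (forall A, measurable A -> pr nu (T @^-1` A) = pr nu A) ->
  (forall A, measurable A -> T @^-1` A = A -> pr nu A = 0 \/ pr nu (~` A) = 0) ->
  (forall A, measurable A -> pr nu A = 0 -> pr m A = 0) ->
  forall A, measurable A -> m A = nu A.
Proof.
move=> mT minv nuinv erg ac.
have [Q [N []]] := Hahn_decomposition
  (cadd (charge_of_finite_measure m) (copp (charge_of_finite_measure nu))).
move=> [mQ Q0] [mN N0] QN QN0.
pose s A := pr m A - pr nu A.
have sE A : measurable A ->
    cadd (charge_of_finite_measure m) (copp (charge_of_finite_measure nu)) A = (s A)%:E.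
  by move=> mA; rewrite EFinB -!prE.
have {}Q0 A : measurable A -> A `<=` Q -> 0 <= s A.
  by move=> mA AQ; rewrite -lee_fin -sE//; apply: Q0; rewrite ?inE.
have {}N0 A : measurable A -> A `<=` N -> s A <= 0.
  by move=> mA AN; rewrite -lee_fin -sE//; apply: N0; rewrite ?inE.
have sDI A B : measurable A -> measurable B -> s A = s (A `\` B) + s (A `&` B).
  by move=> mA mB; rewrite /s (pr_setDI m mA mB) (pr_setDI nu mA mB); ring.
have sQ A : measurable A -> s A <= s Q.
  move=> mA; rewrite (sDI A Q)// (sDI Q A)// setIC.
  have h1 : s (A `\` Q) <= 0.
    apply: N0; first exact: measurableD.
    by move=> x [_ nQ]; have : setT x by []; rewrite -QN => -[].
  have h2 : 0 <= s (Q `\` A) by apply: Q0; [exact: measurableD|exact: subDsetl].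
  lra.
pose maximal A := measurable A /\ s A = s Q.
have maxU A B : maximal A -> maximal B -> maximal (A `|` B).
  move=> [mA sA] [mB sB]; have mAB := measurableU _ _ mA mB.
  have mI := measurableI _ _ mA mB.
  split => //; have := sQ _ mAB; have := sQ _ mI.
  have : s (A `|` B) + s (A `&` B) = s A + s B.
    by rewrite /s; have := pr_setUI m mA mB; have := pr_setUI nu mA mB; lra.
  lra.
have max_lim (F : nat -> set U) A : measurable A ->
    (forall p : probability U R, pr p (F n) @[n --> \oo] --> pr p A) ->
    (forall n, maximal (F n)) -> maximal A.
  move=> mA FA mF; split => //.
  have : s (F n) @[n --> \oo] --> s A by apply: cvgB; exact: FA.
  have -> : (fun n => s (F n)) = fun=> s Q by apply/funext => n; have [] := mF n.
  by move=> /cvg_lim => <- //; rewrite lim_cst.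
have maxT A : maximal A -> maximal (T @^-1` A).
  move=> [mA sA]; have mTA : measurable (T @^-1` A).
    by rewrite -[X in measurable X]setTI; exact: mT.
  by split => //; rewrite -sA /s minv// nuinv.
pose F n := iter n (fun A => T @^-1` A) Q.
have maxF n : maximal (F n).
  by elim: n => [|n IH]; [split|exact: maxT].
pose G n := \bigcup_i F (n + i)%N.
have maxG n : maximal (G n).
  pose H j := \big[setU/set0]_(i < j.+1) F (n + i)%N.
  have maxH j : maximal (H j).
    elim: j => [|j IH]; rewrite /H; first by rewrite big_ord1; exact: maxF.
    by rewrite big_ord_recr; apply: maxU => //; exact: maxF.
  have -> : G n = \bigcup_j H j.
    apply/seteqP; split=> [x [i _ Fx]|x [j _]].
      by exists i => //; rewrite /H big_ord_recr/=; right.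
    by rewrite /H -(bigcup_mkord j.+1 (fun i => F (n + i)%N)) => -[i _ ?]; exists i.
  apply: (max_lim H) => //.
    by apply: bigcupT_measurable => j; case: (maxH j).
  move=> p; apply: cvg_pr_bigcup; first by move=> j; case: (maxH j).
  move=> i j ij; apply/subsetPset.
  exact: (@subset_bigsetU _ (fun i => F (n + i)%N)).
have G_dec : nonincreasing_seq G.
  move=> i j ij; apply/subsetPset => x [l _ Fx]; exists (j - i + l)%N => //.
  by rewrite addnA subnKC.
pose E := \bigcap_n G n.
have [mE sE'] : maximal E.
  apply: (max_lim G) => //; last first.
    by move=> p; apply: cvg_pr_bigcap => // n; case: (maxG n).
  by apply: bigcapT_measurable => n; case: (maxG n).
have TE : T @^-1` E = E.
  apply/seteqP; split=> x Ex n _.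
    have [i _ Fi] := Ex n I; exists i.+1 => //.
    by rewrite addnS.
  by have [i _ Fi] := Ex n.+1 I; exists i => //; rewrite addSn in Fi.
have s0 : s Q = 0.
  rewrite -sE' /s; have [E0|E0] := erg E mE TE; first by rewrite E0 ac// subrr.
  have := ac _ (measurableC mE) E0.
  by move: E0; rewrite !prC//; lra.
move=> A mA; rewrite !prE//; congr (_%:E); apply/eqP; rewrite -subr_eq0 eq_le.
have := sQ A mA; have := sQ _ (measurableC mA); rewrite /s !prC// -/(s Q) s0.
by move=> h1 h2; apply/andP; split; [|lra].
Qed.

End ergodic_uniqueness.

Section absolute_continuity.
Variables (R : realType) (k : nat) (X : subshift k).
Local Notation S := (shift_space X).
Local Notation T := (@shift_map k X).
Variables m nu : probability S R.
Hypothesis nu_gt0 : forall n x, 0 < pr nu (cylinder n x).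

Lemma law_word_gt0 n w : 0 < law m (@word k X n) w -> 0 < law nu (@word k X n) w.
Proof. by move=> /law_gt0_ex[x <-]; rewrite law_word. Qed.

Lemma determined_word n V : determined n V ->
  V = @word k X n @^-1` [set` [pred w | `[< exists2 x, V x & word n x = w >]]].
Proof.
move=> dV; apply/seteqP; split=> x /=; rewrite unfold_in /=.
  by move=> Vx; apply/asboolP; exists x.
by move=> /asboolP[y Vy /wordP yx]; exact: dV yx Vy.
Qed.

(** Given nu A = 0 and s > 0, let V be determined by finitely many letters and
expR (- s)-close to A for both measures.  Then [relative_entropy_event] gives
m V * s <= K + ln 2, so m A is at most of order 1 / s. *)
Lemma bounded_relative_entropy_dominated (K : R) :
  (forall n, (0 < n)%N -> mean m (@word k X n)
    (fun w => ln (law m (@word k X n) w) - ln (law nu (@word k X n) w)) <= K) ->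
  forall A, measurable A -> pr nu A = 0 -> pr m A = 0.
Proof.
move=> HK A mA nuA; apply/eqP; rewrite eq_le pr_ge0 andbT.
have K0 : 0 <= K + 1 + ln 2.
  have := HK 1 isT; have l2 : 0 <= ln 2 :> R by apply: ln_ge0; rewrite ler1n.
  suff : 0 <= mean m (@word k X 1)
      (fun w => ln (law m (@word k X 1) w) - ln (law nu (@word k X 1) w)).
    by lra.
  rewrite /mean (eq_bigr _ (fun w _ => mulrBr _ _ _)) sumrB subr_ge0.
  apply: gibbs_inequality => [w|w|w|];
    [exact: law_ge0|exact: law_ge0|exact: law_word_gt0|].
  by rewrite !law_sum1//; exact: measurable_word.
suff bnd s : 0 < s -> pr m A <= (K + 1 + ln 2) / s.
  apply/ler_addgt0Pr => e e0; rewrite add0r.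
  apply: le_trans (bnd ((K + 1 + ln 2 + 1) / e) _) _; first by rewrite divr_gt0; lra.
  rewrite invf_div mulrCA ler_piMr ?(ltW e0)// ler_pdivrMr; lra.
move=> s0; pose t := expR (- s).
have t0 : 0 < t by exact: expR_gt0.
have [_ /(_ t t0)[N0 [V [dV0 mV nuV]]]] := borel_approximable m nu mA.
have dV : determined N0.+1 V by exact: determined_le dV0.
have mesV := measurable_determined dV.
have nuVt : pr nu V <= t.
  have := pr_setY nu mesV mA; rewrite setYC nuA; lra.
(* t^-1 has logarithm s *)
have mVs : pr m V * s <= K + ln 2.
  set P := [pred w | `[< exists2 x, V x & word N0.+1 x = w >]].
  have VP := determined_word dV; rewrite -/P in VP.
  have := relative_entropy_event (p := law m (@word k X N0.+1))
    (q := law nu (@word k X N0.+1)) (A := P) (K := K) (t := t).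
  have mw := @measurable_word k X N0.+1.
  rewrite -(pr_label m mw P) -(pr_label nu mw P) -!VP.
  rewrite /t -expRN opprK expRK; apply => //.
  - by move=> w; exact: law_ge0.
  - by move=> w; exact: law_ge0.
  - by move=> w; exact: law_word_gt0.
  - by apply: law_sum1; exact: measurable_word.
  - by apply: law_sum1; exact: measurable_word.
  - exact: HK.
have ts : t * s <= 1.
  rewrite /t expRN mulrC ler_pdivrMr ?expR_gt0// mul1r.
  by apply: le_trans (expR_ge1Dx s); lra.
rewrite ler_pdivlMr//.
have := pr_setY m mA mesV => h.
have : pr m A * s <= (pr m V + t) * s by rewrite ler_pM2r//; lra.
rewrite mulrDl; lra.
Qed.

End absolute_continuity.

Section mixing.
Variables (R : realType) (k : nat) (X : subshift k).
Local Notation S := (shift_space X).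
Local Notation T := (@shift_map k X).
Variable nu : probability S R.
Hypothesis nuinv : shift_invariant nu.
Variables (p : nat) (c : R).
Hypothesis c0 : 0 < c.
Hypothesis mix : forall n l x y,
  c * (pr nu (cylinder n x) * pr nu (cylinder l y)) <=
  \sum_(j < p.+1) pr nu (cylinder n x `&` iter (n + j) T @^-1` cylinder l y).

(** Sum [mix] over the words of V and of W.  A word that does not occur in X has
measure 0. *)
Lemma mixing_determined n l (V W : set S) : determined n V -> determined l W ->
  c * (pr nu V * pr nu W) <=
  \sum_(j < p.+1) pr nu (V `&` iter (n + j) T @^-1` W).
Proof.
move=> dV dW.
set PV := [pred w | `[< exists2 x : S, V x & word n x = w >]].
set PW := [pred w | `[< exists2 x : S, W x & word l x = w >]].
have VE : V = @word k X n @^-1` [set` PV] := determined_word dV.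
have WE : W = @word k X l @^-1` [set` PW] := determined_word dW.
have mn := @measurable_word k X n.
have ml := @measurable_word k X l.
have -> : pr nu V = \sum_(u in PV) law nu (@word k X n) u by rewrite {1}VE pr_label.
have -> : pr nu W = \sum_(u in PW) law nu (@word k X l) u by rewrite {1}WE pr_label.
pose z j x := (@word k X n x, (@word k X l \o iter (n + j) T) x).
have mz j : measurable_label (z j).
  by apply: measurable_label_pair => //; exact: measurable_label_iter.
have zE j : pr nu (V `&` iter (n + j) T @^-1` W) =
    \sum_(u in PV) \sum_(w in PW) law nu (z j) (u, w).
  have := pr_label nu (mz j) [pred c | (c.1 \in PV) && (c.2 \in PW)].
  rewrite pair_big_dep/= => E.
  rewrite (eq_bigr (fun c => law nu (z j) c)) => [|[u w] _ //]; rewrite -E.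
  congr (pr nu _); rewrite {1}VE {1}WE.
  by apply/seteqP; split=> x /=; rewrite !unfold_in/= => /andP.
rewrite (eq_bigr (fun j : 'I_p.+1 =>
  \sum_(u in PV) \sum_(w in PW) law nu (z j) (u, w))); last by move=> j _; exact: zE.
rewrite exchange_big/= mulr_suml mulr_sumr.
apply: ler_sum => u _; rewrite exchange_big/= !mulr_sumr; apply: ler_sum => w _.
have [u0|u0] := eqVneq (law nu (@word k X n) u) 0.
  by rewrite u0 mul0r mulr0 sumr_ge0// => j _; exact: law_ge0.
have [w0|w0] := eqVneq (law nu (@word k X l) w) 0.
  by rewrite w0 !mulr0 sumr_ge0// => j _; exact: law_ge0.
have [x xu] : exists x : S, word n x = u.
  by apply: (@law_gt0_ex _ _ _ nu _ (@word k X n) u); rewrite lt_def u0 law_ge0.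
have [y yw] : exists y : S, word l y = w.
  by apply: (@law_gt0_ex _ _ _ nu _ (@word k X l) w); rewrite lt_def w0 law_ge0.
rewrite -xu -yw !law_word; apply: le_trans (mix n l x y) _.
apply: ler_sum => j _; rewrite /law /z.
rewrite le_eqVlt; apply/orP; left; apply/eqP; congr (pr nu _).
rewrite -!preimage_word; apply/seteqP; split=> a /=; first by move=> [-> ->].
by move=> [-> ->].
Qed.

(** Let V approximate A and W approximate ~` A.  An orbit that goes from V to W leaves
the invariant set A unless one of the approximations fails at one of its ends,
so [mixing_determined] makes nu A * nu (~` A) arbitrarily small. *)
Lemma mixing_ergodic A : measurable A -> T @^-1` A = A ->
  pr nu A = 0 \/ pr nu (~` A) = 0.
Proof.
move=> mA TA.
have TAn n x : A x -> A (iter n T x).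
  by elim: n x => [//|n IH] x Ax; rewrite iterSr; apply: IH; rewrite -TA in Ax.
have mC := measurableC mA.
set a := pr nu A; set b := pr nu (~` A).
have a0 : 0 <= a by exact: pr_ge0.
have b0 : 0 <= b by exact: pr_ge0.
have a1 : a <= 1 by exact: pr_le1.
have b1 : b <= 1 by exact: pr_le1.
suff ab : a * b <= 0.
  have : a * b == 0 by rewrite eq_le ab mulr_ge0.
  by rewrite mulf_eq0 => /orP[] /eqP ?; [left|right].
(* as all measures are at most 1, a * b <= pr nu V * pr nu W + 3 * t *)
pose K : R := (p.+1%:R * 2) / c + 3.
have K0 : 0 < K by rewrite /K ltr_wpDl// divr_ge0// ltW.
suff bnd (t : R) : 0 < t < 1 -> a * b <= K * t.
  apply/ler_addgt0Pr => e e0; rewrite add0r.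
  pose t : R := Num.min (2^-1) (e / K).
  have t0 : 0 < t by rewrite /t lt_min invr_gt0 divr_gt0 ?ltr0n.
  have t1 : t <= 2^-1 by rewrite /t ge_min lexx.
  have tK : t <= e / K by rewrite /t ge_min lexx orbT.
  apply: le_trans (bnd t _) _; first by rewrite t0/=; lra.
  by rewrite mulrC -ler_pdivlMr.
move=> /andP[t0 t1].
have [_ /(_ t t0)[n [V [dV AV _]]]] := borel_approximable nu nu mA.
have [_ /(_ t t0)[l [W [dW CW _]]]] := borel_approximable nu nu mC.
have mV := measurable_determined dV.
have mW := measurable_determined dW.
have mYV : measurable (A `+` V) by apply: measurableU; exact: measurableD.
have mYW : measurable (~` A `+` W) by apply: measurableU; exact: measurableD.
have aV : a <= pr nu V + pr nu (A `+` V) := pr_setY nu mA mV.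
have bW : b <= pr nu W + pr nu (~` A `+` W) := pr_setY nu mC mW.
have V1 := pr_le1 nu mV.
have W1 := pr_le1 nu mW.
have V0 := pr_ge0 nu V.
have W0 := pr_ge0 nu W.
have h : c * (pr nu V * pr nu W) <= p.+1%:R * (2 * t).
  apply: le_trans (mixing_determined dV dW) _.
  have -> : p.+1%:R * (2 * t) = \sum_(j < p.+1) (2 * t).
    by rewrite sumr_const card_ord mulr_natl.
  apply: ler_sum => j _.
  have mTW : measurable (iter (n + j) T @^-1` W) by exact: measurable_preimage_iter.
  have mTY : measurable (iter (n + j) T @^-1` (~` A `+` W)).
    exact: measurable_preimage_iter.
  apply: (@le_trans _ _ (pr nu ((A `+` V) `|` iter (n + j) T @^-1` (~` A `+` W)))).
    apply: pr_le; [exact: measurableI|exact: measurableU|].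
    move=> x [Vx Wx]; have [Ax|nAx] := pselect (A x).
      by right; right; split => //= nA; apply: nA; exact: TAn.
    by left; right.
  apply: le_trans (pr_setU nu mYV mTY) _.
  by rewrite pr_iter//; lra.
have h2 : pr nu V * pr nu W <= (p.+1%:R * 2) / c * t.
  by rewrite -mulrA (mulrC c^-1) mulrA ler_pdivlMr// mulrC -mulrA.
rewrite /K mulrDl.
have : a * b <= (pr nu V + t) * (pr nu W + t) by apply: ler_pM => //; lra.
nra.
Qed.

End mixing.

(** * Integrals of bounded Borel functions *)

Section bounded_integrals.
Variables (R : realType) (k : nat) (X : subshift k).
Local Notation S := (shift_space X).
Local Notation T := (@shift_map k X).
Variable m : probability S R.
Implicit Types g h : S -> R.

Lemma bounded_borel_integrable g : bounded_borel g -> m.-integrable setT (EFin \o g).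
Proof.
move=> [[M gM] mg]; apply: measurable_bounded_integrable => //.
  by rewrite ltey_eq fin_num_measure.
by exists M; split => [|N MN x _]; [exact: num_real|exact: le_trans (gM x) (ltW MN)].
Qed.

Lemma integral_bounded_borel g : bounded_borel g ->
  (\int[m]_x (g x)%:E)%E = (\int[m]_x g x)%:E.
Proof.
move=> /bounded_borel_integrable gi; rewrite /Rintegral fineK//.
exact: (integrable_fin_num measurableT gi).
Qed.

Lemma bounded_borelD g h : bounded_borel g -> bounded_borel h ->
  bounded_borel (fun x => g x + h x).
Proof.
move=> [[M gM] mg] [[N hN] mh]; split; last exact: measurable_funD.
by exists (M + N) => x; apply: le_trans (ler_normD _ _) (lerD _ _).
Qed.

Lemma bounded_borel_cst (c : R) : @bounded_borel R k X (fun=> c).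
Proof. by split; [exists `|c| => x | exact: measurable_cst]. Qed.

Lemma bounded_borel_shift g : bounded_borel g -> bounded_borel (g \o T).
Proof.
move=> [[M gM] mg]; split; first by exists M => x; exact: gM.
by apply: measurableT_comp => //; exact: measurable_shift_map.
Qed.

Lemma Rintegral_addr g (c : R) : bounded_borel g ->
  \int[m]_x (g x + c) = \int[m]_x g x + c.
Proof.
move=> gb; rewrite RintegralD//; last 2 first.
- exact: bounded_borel_integrable.
- exact: (bounded_borel_integrable (bounded_borel_cst c)).
by rewrite Rintegral_cst// -[fine _]/(pr m setT) prT mulr1.
Qed.

Lemma Rintegral_near g h (K : R) : bounded_borel g -> bounded_borel h ->
  (forall x, `|g x - h x| <= K) -> `|\int[m]_x g x - \int[m]_x h x| <= K.
Proof.
move=> gb hb gh.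
have gi := bounded_borel_integrable gb; have hi := bounded_borel_integrable hb.
have le u v : bounded_borel u -> bounded_borel v -> (forall x, u x <= v x) ->
    \int[m]_x u x <= \int[m]_x v x.
  by move=> ub vb uv; apply: le_Rintegral => //; exact: bounded_borel_integrable.
have cb (u : S -> R) : bounded_borel u -> bounded_borel (fun x => u x + K).
  by move=> ub; exact: (bounded_borelD ub (bounded_borel_cst K)).
have h1 : \int[m]_x g x <= \int[m]_x h x + K.
  rewrite -Rintegral_addr//; apply: le => // [|x]; first exact: cb.
  by have := gh x; rewrite ler_norml => /andP[]; lra.
have h2 : \int[m]_x h x <= \int[m]_x g x + K.
  rewrite -Rintegral_addr//; apply: le => // [|x]; first exact: cb.
  by have := gh x; rewrite ler_norml => /andP[]; lra.
by rewrite ler_norml; apply/andP; split; lra.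
Qed.

Lemma Rintegral_label (I : finType) (xi : S -> I) (F : I -> R) :
  measurable_label xi -> \int[m]_x F (xi x) = mean m xi F.
Proof.
move=> mxi; rewrite /Rintegral.
pose u (a : I) (x : S) : \bar R := (F a * \1_(xi @^-1` [set a]) x)%:E.
have ui a : m.-integrable setT (u a).
  apply: (@bounded_borel_integrable (fun x => F a * \1_(xi @^-1` [set a]) x)).
  split; last by apply: measurable_funM => //; exact: measurable_indic.
  exists `|F a| => x; rewrite normrM ler_piMr// indicE.
  by case: (_ \in _); rewrite ?normr1 ?normr0.
have -> : (\int[m]_x (F (xi x))%:E)%E = (\int[m]_x (\sum_a u a x))%E.
  apply: eq_integral => x _; rewrite sumEFin (bigD1 (xi x))//= big1 ?addr0.
    by rewrite indicE mem_set// mulr1.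
  by move=> a ax; rewrite indicE memNset ?mulr0// => /= xa; rewrite xa eqxx in ax.
rewrite integral_sum// (eq_bigr (fun a => (law m xi a * F a)%:E)).
  by rewrite sumEFin.
move=> a _; transitivity
  (\int[m]_x ((F a)%:E * (\1_(xi @^-1` [set a]) x : R)%:E))%E; first by [].
rewrite integralZl//; last first.
  apply: (@bounded_borel_integrable (\1_(xi @^-1` [set a]))).
  split; last exact: measurable_indic.
  exists 1 => x; rewrite indicE.
  by case: (_ \in _); rewrite ?normr1 ?normr0.
rewrite integral_indic// setIT mulrC EFinM; congr (_ * _)%E.
exact: prE.
Qed.

Hypothesis minv : shift_invariant m.

Lemma Rintegral_shift g : bounded_borel g -> \int[m]_x g (T x) = \int[m]_x g x.
Proof.
move=> gb; rewrite /Rintegral.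
have := integral_pushforward (measurable_shift_map (X := X)) (mu := m) (D := setT)
  (f := EFin \o g).
rewrite preimage_setT => /(_ _ _ measurableT) <-.
- congr fine; apply: eq_measure_integral; first exact: measurable_shift_map.
  by move=> mT A mA _; exact: minv.
- by apply/measurable_EFinP; case: gb.
- exact: bounded_borel_integrable (bounded_borel_shift gb).
Qed.

Lemma birkhoff_sumS g n x :
  birkhoff_sum g n.+1 x = g x + birkhoff_sum g n (T x).
Proof.
rewrite /birkhoff_sum big_ord_recl/=; congr (_ + _); apply: eq_bigr => i _.
by rewrite -iterSr.
Qed.

Lemma bounded_borel_birkhoff g n : bounded_borel g -> bounded_borel (birkhoff_sum g n).
Proof.
move=> gb; elim: n => [|n IH].
  have -> : birkhoff_sum g 0 = fun=> 0.
    by apply/funext => x; rewrite /birkhoff_sum big_ord0.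
  exact: bounded_borel_cst.
have -> : birkhoff_sum g n.+1 = fun x => g x + (birkhoff_sum g n \o T) x.
  by apply/funext => x; exact: birkhoff_sumS.
by apply: bounded_borelD => //; exact: bounded_borel_shift.
Qed.

Lemma Rintegral_birkhoff g n : bounded_borel g ->
  \int[m]_x birkhoff_sum g n x = n%:R * \int[m]_x g x.
Proof.
move=> gb; elim: n => [|n IH].
  rewrite mul0r (eq_Rintegral _ (g := fun=> 0)) ?Rintegral_cst ?mul0r// => x _.
  by rewrite /birkhoff_sum big_ord0.
rewrite (eq_Rintegral _ (g := fun x => g x + (birkhoff_sum g n \o T) x)); last first.
  by move=> x _; exact: birkhoff_sumS.
have nb := bounded_borel_birkhoff n gb.
rewrite RintegralD//; last 2 first.
- exact: bounded_borel_integrable.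
- exact: (bounded_borel_integrable (bounded_borel_shift nb)).
by rewrite Rintegral_shift// IH -natr1 mulrDl mul1r addrC.
Qed.

End bounded_integrals.

(** * The potential r *)

Section limit_lemmas.
Variable R : realType.

(** The sequence lies between its tail infima and tail suprema; boundedness makes
their common limit finite. *)
Lemma cvg_of_limn_einf_esup (u : nat -> R) (M : R) :
  (\forall n \near \oo, `|u n| <= M) ->
  limn_einf (EFin \o u) = limn_esup (EFin \o u) -> cvgn u.
Proof.
move=> uM eqU.
have ci := @is_cvg_einfs R (EFin \o u); have cs := @is_cvg_esups R (EFin \o u).
set l := limn_esup (EFin \o u) in eqU.
have cl : (EFin \o u) n @[n --> \oo] --> l.
  apply: (@squeeze_cvge _ _ _ _ (einfs (EFin \o u)) _ (esups (EFin \o u))).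
  - apply: nearW => n; apply/andP; split.
      by apply: ereal_inf_lbound; exists n => /=.
    by apply: ereal_sup_ubound; exists n => /=.
  - by rewrite -eqU limn_einf_lim.
  - by rewrite /l limn_esup_lim.
have lM : (l <= M%:E)%E.
  apply: (cvge_to_le cl); near=> n.
  rewrite lee_fin (le_trans (ler_norm _))//; by near: n.
have Ml : ((- M)%:E <= l)%E.
  apply: (cvge_to_ge cl); near=> n.
  rewrite lee_fin lerNl (le_trans (ler_norm _))// normrN; by near: n.
have lfin : l \is a fin_num.
  by rewrite fin_numE -ltNye -ltey (lt_le_trans (ltNyr _) Ml) (le_lt_trans lM (ltry _)).
by move: cl; rewrite -(fineK lfin) => /fine_cvg cl; apply/cvg_ex; exists (fine l).
Unshelve. all: by end_near. Qed.

End limit_lemmas.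

Section gibbs_potential.
Variables (R : realType) (k : nat) (X : subshift k).
Local Notation S := (shift_space X).
Local Notation T := (@shift_map k X).
Variables (f : nat -> S -> R) (nu : probability S R) (P C0 : R).
Hypotheses (f_gt0 : forall n x, (0 < n)%N -> 0 < f n x) (hC0 : 0 < C0)
  (hgibbs : gibbs_bounds nu f P (fun=> C0)).

Definition log_cylinder (n : nat) (x : S) : R := ln (pr nu (cylinder n x)).

Lemma gibbs_cylinder_gt0 n x : 0 < pr nu (cylinder n x).
Proof.
case: n => [|n].
  have -> : cylinder 0 x = setT by apply/seteqP; split.
  by rewrite prT.
have /andP[h _] := hgibbs x (ltn0Sn n).
have : 0 < pr nu (cylinder n.+1 x) / (expR (- (n.+1%:R * P)) * f n.+1 x).
  by apply: lt_le_trans h; rewrite invr_gt0.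
by rewrite pmulr_lgt0// invr_gt0 mulr_gt0 ?expR_gt0 ?f_gt0.
Qed.

Lemma log_cylinder0 x : log_cylinder 0 x = 0.
Proof.
rewrite /log_cylinder; have -> : cylinder 0 x = setT by apply/seteqP; split.
by rewrite prT ln1.
Qed.

Lemma log_cylinder_near n x : (0 < n)%N ->
  `|log_cylinder n x + n%:R * P - ln (f n x)| <= ln C0.
Proof.
move=> n0; have := hgibbs x n0; rewrite -/(pr _ _).
have c0 := gibbs_cylinder_gt0 n x; have f0 := f_gt0 x n0.
have e0 := expR_gt0 (- (n%:R * P)).
have q0 : 0 < pr nu (cylinder n x) / (expR (- (n%:R * P)) * f n x).
  by rewrite divr_gt0// mulr_gt0.
have -> : log_cylinder n x + n%:R * P - ln (f n x) =
    ln (pr nu (cylinder n x) / (expR (- (n%:R * P)) * f n x)).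
  by rewrite ln_div ?posrE ?mulr_gt0// lnM ?posrE// expRK /log_cylinder; ring.
rewrite ler_norml => /andP[h1 h2]; apply/andP; split.
  by rewrite -lnV ?posrE// ler_ln ?posrE// invr_gt0.
by rewrite ler_ln ?posrE.
Qed.

Lemma ln_gibbs_constant_ge0 : 0 <= ln C0.
Proof. exact: le_trans (log_cylinder_near point (ltn0Sn 0)). Qed.

(** There are finitely many words of length n. *)
Lemma log_cylinder_bounded n : exists B, forall x, `|log_cylinder n x| <= B.
Proof.
exists (\sum_w `|ln (law nu (@word k X n) w)|) => x.
by rewrite /log_cylinder -law_word (bigD1 (word n x))//= lerDl sumr_ge0.
Qed.

Lemma log_ratioE x n : log_ratio nu x n = log_cylinder n x - log_cylinder n.-1 (T x).
Proof. by rewrite /log_ratio ln_div// posrE; exact: gibbs_cylinder_gt0. Qed.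

Variable C : nat -> R.
Hypothesis hadd : additive_up_to f C.

Lemma ln_additive n l x : (0 < n)%N -> (0 < l)%N ->
  `|ln (f (n + l)%N x) - ln (f n x) - ln (f l (iter n T x))| <= C n.
Proof.
move=> n0 l0; have [] := hadd x n0 l0.
have nl0 : (0 < n + l)%N by rewrite addn_gt0 n0.
have f1 := f_gt0 x n0; have f2 := f_gt0 (iter n T x) l0; have f3 := f_gt0 x nl0.
have e1 := expR_gt0 (- C n); have e2 := expR_gt0 (C n).
rewrite -ler_ln ?posrE ?mulr_gt0// !lnM ?posrE ?mulr_gt0// expRK => h1.
rewrite -ler_ln ?posrE ?mulr_gt0// !lnM ?posrE ?mulr_gt0// expRK => h2.
by rewrite ler_norml; apply/andP; split; lra.
Qed.

(** The Gibbs property turns the near-additivity of ln f into that of log_cylinder.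
The bound does not depend on M. *)
Lemma log_cylinder_increment n M x : (0 < n)%N -> (0 < M)%N ->
  `|log_cylinder (M + n) x - log_cylinder M (iter n T x) + n%:R * P - ln (f n x)|
    <= C n + 2 * ln C0.
Proof.
move=> n0 M0.
have nM0 : (0 < M + n)%N by rewrite addn_gt0 M0.
have h1 := log_cylinder_near x nM0.
have h2 := log_cylinder_near (iter n T x) M0.
have := ln_additive x n0 M0; rewrite (addnC n M).
move: h1 h2; rewrite natrD mulrDl !ler_norml => /andP[? ?] /andP[? ?] /andP[? ?].
apply/andP; split; lra.
Qed.

Hypothesis hr : forall x : S, r_lower nu P x = r_upper nu P x.

Local Notation r := (r_limit nu P).

Lemma cvg_log_ratio x : log_ratio nu x n @[n --> \oo] --> r x - P.
Proof.
rewrite /r_limit addrK; apply: (@cvg_of_limn_einf_esup _ _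
  (C 1%N + 2 * ln C0 + `|P| + `|ln (f 1%N x)|)).
  near=> n.
  have n1 : (1 < n)%N by near: n; exact: nbhs_infty_gt.
  have n0 : (0 < n.-1)%N by lia.
  have := log_cylinder_increment x (ltn0Sn 0) n0.
  rewrite addn1 prednK ?(ltnW n1)// -log_ratioE mul1r => h.
  have -> : log_ratio nu x n = (log_ratio nu x n + P - ln (f 1%N x)) - P + ln (f 1%N x).
    by ring.
  apply: le_trans (ler_normD _ _) _; rewrite lerD2r.
  by apply: le_trans (ler_normB _ _) _; rewrite lerD2r.
have := hr x; rewrite /r_lower /r_upper => /(congr1 (fun y => (y - P%:E)%E)).
by rewrite !addeK.
Unshelve. all: by end_near. Qed.

(** The logarithmic ratios that define r telescope along the orbit of x. *)
Lemma cvg_log_cylinder_increment n x :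
  (log_cylinder (M + n) x - log_cylinder M (iter n T x)) @[M --> \oo]
    --> birkhoff_sum r n x - n%:R * P.
Proof.
elim: n x => [|n IH] x.
  rewrite /birkhoff_sum big_ord0 mul0r subrr.
  under eq_fun => M do rewrite addn0 subrr.
  exact: cvg_cst.
rewrite birkhoff_sumS -natr1 mulrDl mul1r.
have -> : r x + birkhoff_sum r n (T x) - (n%:R * P + P) =
  (r x - P) + (birkhoff_sum r n (T x) - n%:R * P) by ring.
have -> : (fun M => log_cylinder (M + n.+1) x - log_cylinder M (iter n.+1 T x)) =
    (fun M => log_ratio nu x (M + n.+1)%N +
      (log_cylinder (M + n) (T x) - log_cylinder M (iter n T (T x)))).
  by apply/funext => M; rewrite log_ratioE addnS /= -iterSr /=; ring.
apply: cvgD; last exact: IH.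
by have := @cvg_log_ratio x; rewrite -(cvg_shiftn n.+1).
Qed.

(** Let M tend to infinity in [log_cylinder_increment]. *)
Lemma birkhoff_sum_near n x : (0 < n)%N ->
  `|birkhoff_sum r n x - ln (f n x)| <= C n + 2 * ln C0.
Proof.
move=> n0.
have -> : birkhoff_sum r n x - ln (f n x) =
  birkhoff_sum r n x - n%:R * P + (n%:R * P - ln (f n x)) by ring.
apply: (cvgr_to_le (F := \oo) (f := fun M => `|log_cylinder (M + n) x -
    log_cylinder M (iter n T x) + (n%:R * P - ln (f n x))|)).
  by apply: cvg_norm; exact: cvgD (@cvg_log_cylinder_increment n x) (cvg_cst _).
near=> M; rewrite addrA; apply: log_cylinder_increment => //.
by near: M; exact: nbhs_infty_gt.
Unshelve. all: by end_near. Qed.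

(** The error C n + 2 * ln C0 of [birkhoff_sum_near], plus ln C0 for passing from
ln f to the measure of the cylinder. *)
Definition birkhoff_error n := C n + 3 * ln C0.

Lemma birkhoff_sum_near_cylinder n x : (0 < n)%N ->
  `|birkhoff_sum r n x - (log_cylinder n x + n%:R * P)| <= birkhoff_error n.
Proof.
move=> n0; have := birkhoff_sum_near x n0; have := log_cylinder_near x n0.
rewrite /birkhoff_error !ler_norml => /andP[? ?] /andP[? ?]; apply/andP; split; lra.
Qed.

Lemma r_limit_bounded_borel : bounded_borel r.
Proof.
split.
  have [B hB] := log_cylinder_bounded 1.
  exists (B + `|P| + birkhoff_error 1) => x.
  have := birkhoff_sum_near_cylinder x (ltn0Sn 0).
  rewrite /birkhoff_sum big_ord1/= mul1r => h.
  have -> : r x = log_cylinder 1 x + P + (r x - (log_cylinder 1 x + P)) by ring.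
  apply: le_trans (ler_normD _ _) (lerD _ h).
  by apply: le_trans (ler_normD _ _) _; rewrite lerD2r.
apply: (@measurable_fun_cvg _ _ _ _ (fun n x => log_ratio nu x n + P)).
  move=> n; apply: (@measurable_fun_letters _ _ _ n) => x y xy.
  rewrite !log_ratioE /log_cylinder (eq_cylinder xy).
  rewrite (@eq_cylinder _ _ n.-1 (T x) (T y))// => i lin.
  by rewrite !letter_shift_map xy//; lia.
move=> x _; rewrite -[X in _ --> X](subrK P); apply: cvgD; last exact: cvg_cst.
exact: cvg_log_ratio.
Qed.

Section invariant_integral.
Variable m : probability S R.
Hypothesis minv : shift_invariant m.

(** By invariance the n-th Birkhoff sum of r integrates to n times the integral of r. *)
Lemma mean_log_integral_cvg (g : nat -> S -> R) (D : nat -> R) :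
  (forall n, (0 < n)%N -> measurable_fun setT (fun x => ln (g n x))) ->
  (forall n x, (0 < n)%N -> `|birkhoff_sum r n x - ln (g n x)| <= D n) ->
  D n / n%:R @[n --> \oo] --> 0 ->
  mean_log_integral g m @ \oo --> (\int[m]_x (r x)%:E)%E.
Proof.
move=> mg gD D0; have rb := r_limit_bounded_borel.
have gb n : (0 < n)%N -> bounded_borel (fun x => ln (g n x)).
  move=> n0; split; last exact: mg.
  have [[B hB] _] := bounded_borel_birkhoff n rb.
  exists (B + D n) => x.
  have -> : ln (g n x) = birkhoff_sum r n x - (birkhoff_sum r n x - ln (g n x)) by ring.
  by apply: le_trans (ler_normB _ _) (lerD _ _) => //; exact: gD.
rewrite integral_bounded_borel//.
have : (n%:R^-1 * \int[m]_x ln (g n x)) @[n --> \oo] --> \int[m]_x r x.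
  apply/cvgrPdist_le => e e0.
  have /cvgrPdist_le/(_ e e0) := D0; apply: filter_app; near=> n.
  have n0 : (0 < n)%N by near: n; exact: nbhs_infty_gt.
  have nR : 0 < n%:R :> R by rewrite ltr0n.
  rewrite sub0r normrN => /(le_trans (ler_norm _)) De.
  have h := Rintegral_near m (bounded_borel_birkhoff n rb) (gb n n0)
    (fun x => gD n x n0).
  rewrite Rintegral_birkhoff// in h.
  have -> : \int[m]_x r x - n%:R^-1 * \int[m]_x ln (g n x) =
      (n%:R * \int[m]_x r x - \int[m]_x ln (g n x)) / n%:R.
    by rewrite mulrBl (mulrC n%:R) mulfK ?gt_eqF// (mulrC _ n%:R^-1).
  rewrite normrM (ger0_norm (x := n%:R^-1)) ?invr_ge0//.
  by apply: le_trans De; rewrite ler_pM2r ?invr_gt0.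
move=> h; apply: (@cvg_trans _
  ((fun n => (n%:R^-1 * \int[m]_x ln (g n x))%:E) @ \oo)); last first.
  by apply: cvg_EFin; [exact: nearW|exact: h].
apply: near_eq_cvg; near=> n.
have n0 : (0 < n)%N by near: n; exact: nbhs_infty_gt.
by rewrite /mean_log_integral integral_bounded_borel//; exact: gb.
Unshelve. all: by end_near. Qed.

End invariant_integral.
End gibbs_potential.

(** * The variational principle *)

Section variational_principle.
Variables (R : realType) (k : nat) (X : subshift k).
Local Notation S := (shift_space X).
Local Notation T := (@shift_map k X).
Variables (nu : probability S R) (r : S -> R) (P : R) (D : nat -> R).
Hypotheses (nuinv : shift_invariant nu) (rb : bounded_borel r)
  (nu_gt0 : forall n x, 0 < pr nu (cylinder n x))
  (near_nu : forall n x, (0 < n)%N ->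
    `|birkhoff_sum r n x - (log_cylinder nu n x + n%:R * P)| <= D n).

(** This is [near_nu] integrated against m, the integral of log_cylinder nu j being a
finite sum over words. *)
Lemma mean_log_law m j : shift_invariant m -> (0 < j)%N ->
  `|j%:R * (\int[m]_x r x - P) - mean m (@word k X j) (@ln R \o law nu (@word k X j))|
    <= D j.
Proof.
move=> minv j0.
have -> : mean m (@word k X j) (@ln R \o law nu (@word k X j)) =
    \int[m]_x log_cylinder nu j x.
  rewrite -(Rintegral_label m _ (@measurable_word k X j)).
  by apply: eq_Rintegral => x _; rewrite /= law_word.
have lb : bounded_borel (log_cylinder nu j).
  split; first exact: log_cylinder_bounded.
  apply: (@measurable_fun_letters _ _ _ j) => x y xy.
  by rewrite /log_cylinder (eq_cylinder xy).
have lPb : bounded_borel (fun x => log_cylinder nu j x + j%:R * P).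
  exact: (bounded_borelD lb (bounded_borel_cst _ _)).
have := Rintegral_near m (bounded_borel_birkhoff j rb) lPb
  (fun x => near_nu x j0).
rewrite Rintegral_birkhoff// Rintegral_addr//.
by congr (`|_| <= _); ring.
Qed.

(** The law of words under nu is used to code the words of m. *)
Lemma ent_word_le_pressure m j : shift_invariant m -> (0 < j)%N ->
  ent m (@word k X j) <= j%:R * (P - \int[m]_x r x) + D j.
Proof.
move=> minv j0; have := mean_log_law minv j0; rewrite ler_norml => /andP[_ h].
have mw := @measurable_word k X j.
have := ent_le_mean mw (law_ge0 nu (@word k X j))
  (@law_word_gt0 _ _ _ m nu nu_gt0 j).
rewrite law_sum1// lexx => /(_ isT) h2.
apply: le_trans h2 _.
have -> : j%:R * (P - \int[m]_x r x) = - (j%:R * (\int[m]_x r x - P)) by ring.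
by lra.
Qed.

Hypothesis D0 : D n / n%:R @[n --> \oo] --> 0.

Lemma entropy_add_integral_le m : shift_invariant m ->
  (entropy m + \int[m]_x (r x)%:E <= P%:E)%E.
Proof.
move=> minv; rewrite (integral_bounded_borel m rb) -leeBrDr// -EFinB.
apply/lee_addgt0Pr => e e0.
have [n0 [n0P Dn]] : exists n, (0 < n)%N /\ D n / n%:R <= e.
  have /cvgrPdist_le/(_ e e0)[N _ HN] := D0.
  exists N.+1; split => //; have := HN N.+1 (leqnSn N).
  by rewrite sub0r normrN; apply: le_trans; exact: ler_norm.
apply: le_trans (entropy_le_ent_word minv n0P) _.
rewrite -EFinD lee_fin.
have nR : 0 < n0%:R :> R by rewrite ltr0n.
apply: le_trans (_ : _ <= P - \int[m]_x r x + D n0 / n0%:R) _; last by rewrite lerD2l.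
rewrite ler_pdivrMr// mulrDl divfK ?gt_eqF// mulrC.
exact: ent_word_le_pressure.
Qed.

(** At nu the coding bound is an equality, so the partition by the first letter
already has entropy P minus the integral of r. *)
Lemma entropy_add_integral_eq : (entropy nu + \int[nu]_x (r x)%:E = P%:E)%E.
Proof.
apply/eqP; rewrite eq_le entropy_add_integral_le//=.
rewrite (integral_bounded_borel nu rb) -leeBlDr// -EFinB.
set L := \int[nu]_x r x.
have lim_ent : ent nu (@word k X n) / n%:R @[n --> \oo] --> P - L.
  apply/cvgrPdist_le => e e0; have /cvgrPdist_le/(_ e e0) := D0.
  apply: filter_app; near=> n.
  have n0 : (0 < n)%N by near: n; exact: nbhs_infty_gt.
  have nR : 0 < n%:R :> R by rewrite ltr0n.
  rewrite sub0r normrN => /(le_trans (ler_norm _)); apply: le_trans.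
  have := mean_log_law nuinv n0; rewrite -/L => h.
  have -> : P - L - ent nu (@word k X n) / n%:R =
      - (n%:R * (L - P) - mean nu (@word k X n) (@ln R \o law nu (@word k X n))) / n%:R.
    by rewrite /ent; field; rewrite gt_eqF.
  by rewrite normrM normrN (ger0_norm (x := n%:R^-1)) ?invr_ge0// ler_pM2r ?invr_gt0.
apply: ereal_sup_ubound; exists k, (fun x => letter x 0); split.
  by move=> a; apply: measurable_open; exact: open_letter.
congr (_%:E); apply/esym/cvg_lim => //; exact: lim_ent.
Unshelve. all: by end_near. Qed.

Lemma weak_gibbs_equilibrium_state : equilibrium_state r nu.
Proof.
split=> // m minv; rewrite entropy_add_integral_eq; exact: entropy_add_integral_le.
Qed.

End variational_principle.

(** * Uniqueness *)

Section uniqueness.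
Variables (R : realType) (k : nat) (X : subshift k).
Local Notation S := (shift_space X).
Local Notation T := (@shift_map k X).
Variables (nu : probability S R) (r : S -> R) (P D : R).
Hypotheses (nuinv : shift_invariant nu) (rb : bounded_borel r)
  (nu_gt0 : forall n x, 0 < pr nu (cylinder n x))
  (near_nu : forall n x, (0 < n)%N ->
    `|birkhoff_sum r n x - (log_cylinder nu n x + n%:R * P)| <= D)
  (nu_ergodic : forall A, measurable A -> T @^-1` A = A ->
    pr nu A = 0 \/ pr nu (~` A) = 0).

Lemma gibbs_error_cvg (c : R) : c / n%:R @[n --> \oo] --> (0 : R).
Proof.
rewrite -(mulr0 c); apply: cvgM; first exact: cvg_cst.
by rewrite -(@cvg_shiftS R (fun n => n%:R^-1)); exact: cvg_harmonic.
Qed.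

Lemma bounded_relative_entropy_eq m (K : R) : shift_invariant m ->
  (forall n, (0 < n)%N -> mean m (@word k X n)
    (fun w => ln (law m (@word k X n) w) - ln (law nu (@word k X n) w)) <= K) ->
  forall A, measurable A -> m A = nu A.
Proof.
move=> minv HK; apply: (@dominated_ergodic_eq _ _ _ T) => //.
- exact: measurable_shift_map.
- by move=> A mA; exact: (pr_iter minv 1 mA).
- by move=> A mA; exact: (pr_iter nuinv 1 mA).
- exact: bounded_relative_entropy_dominated HK.
Qed.

(** Since [entropy_le_ent_word] holds for every n without an error term, the entropy
of the words of length n under an equilibrium state m is at least n (P - L), where
L is the integral of r.  With [mean_log_law] this bounds the relative entropy by D
for all n. *)
Lemma equilibrium_state_unique m : equilibrium_state r m ->
  forall A, measurable A -> m A = nu A.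
Proof.
move=> [minv /(_ nu nuinv)].
rewrite (entropy_add_integral_eq nuinv rb nu_gt0 near_nu (gibbs_error_cvg D)).
rewrite (integral_bounded_borel m rb) -leeBlDr// -EFinB => hent.
apply: (@bounded_relative_entropy_eq _ D) => // n n0.
rewrite meanD meanN.
have := mean_log_law rb near_nu minv n0.
have := le_trans hent (entropy_le_ent_word minv n0).
rewrite lee_fin ler_pdivlMr ?ltr0n// /ent ler_norml => h /andP[_ h2].
move: h h2.
rewrite -[mean m _ (@ln R \o law m _)]/(mean m _ (fun w => ln (law m (@word k X n) w))).
rewrite -[mean m _ (@ln R \o law nu _)]/(mean m _ (fun w => ln (law nu (@word k X n) w))).
lra.
Qed.

(** On words w of length n, ln m [w] - ln nu [w] is n (P - P') up to a constant.  If
P' < P and n is large, m would give every word more mass than nu does, which the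
Gibbs inequality excludes.  Hence P <= P', and the relative entropies of m with
respect to nu are bounded above. *)
Lemma gibbs_measure_unique m : gibbs_measure r m ->
  forall A, measurable A -> m A = nu A.
Proof.
move=> [minv [P' [C' [C'0 hm]]]].
have e_gt0 n x : (0 < n)%N -> 0 < expR (birkhoff_sum r n x) by rewrite expR_gt0.
have m_gt0 := gibbs_cylinder_gt0 e_gt0 C'0 hm.
have near_m n x (n0 : (0 < n)%N) := log_cylinder_near e_gt0 C'0 hm x n0.
have diff n x : (0 < n)%N ->
    `|log_cylinder m n x - log_cylinder nu n x - n%:R * (P - P')| <= ln C' + D.
  move=> n0; have := near_m n x n0; have := near_nu x n0.
  rewrite expRK mulrBr !ler_norml => /andP[? ?] /andP[? ?]; apply/andP; split; lra.
have mw n := @measurable_word k X n.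
have PP' : P <= P'.
  rewrite leNgt -subr_gt0; apply/negP => PP0.
  have K0 : 0 <= (ln C' + D) / (P - P').
    by rewrite divr_ge0 ?(ltW PP0)//; exact: le_trans (diff 1%N point isT).
  pose n := (Num.trunc ((ln C' + D) / (P - P'))).+1.
  have nP : ln C' + D < n%:R * (P - P').
    by rewrite -ltr_pdivrMr//; exact: truncnS_gt.
  have : mean nu (@word k X n) (@ln R \o law m (@word k X n)) <=
      mean nu (@word k X n) (@ln R \o law nu (@word k X n)).
    apply: gibbs_inequality => [w|w|w|]; [exact: law_ge0|exact: law_ge0| |].
      exact: law_word_gt0.
    by rewrite !law_sum1.
  apply/negP; rewrite -ltNge -subr_gt0 -meanN -meanD.
  apply: (@lt_le_trans _ _ (mean nu (@word k X n) (fun=> n%:R * (P - P') - (ln C' + D)))).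
    by rewrite /mean -mulr_suml law_sum1// mul1r subr_gt0.
  apply: mean_le => w /law_gt0_ex[x <-] /=.
  rewrite !law_word; have := diff n x isT.
  by rewrite ler_norml /log_cylinder => /andP[]; lra.
apply: (@bounded_relative_entropy_eq _ (ln C' + D)) => // n n0.
have -> : ln C' + D = mean m (@word k X n) (fun=> ln C' + D).
  by rewrite /mean -mulr_suml law_sum1// mul1r.
apply: mean_le => w /law_gt0_ex[x <-] /=.
rewrite !law_word; have := diff n x n0.
have : n%:R * (P - P') <= 0 by rewrite mulr_ge0_le0// subr_le0.
by rewrite ler_norml /log_cylinder => h /andP[_]; lra.
Qed.

End uniqueness.

(** * Mixing of Gibbs measures under weak specification *)

Section specification.
Variables (R : realType) (k : nat) (X : subshift k).
Local Notation S := (shift_space X).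
Local Notation T := (@shift_map k X).

Lemma language_prefix n (x : S) : language X (mkseq (letter x) n).
Proof. by exists n => //; exists x, 0%N. Qed.

(** Weak specification, read on points: a point realizing u w v is moved so that u
starts at its first letter. *)
Lemma weak_specification_point : weak_specification X ->
  exists p, forall n l (x y : S), exists2 j, (j < p.+1)%N &
    exists z, cylinder n x z /\ cylinder l y (iter (n + j) T z).
Proof.
move=> [p hp]; exists p => n l x y.
have [j [w [jp [v [iv wE]] [N _ [z [i zE]]]]]] :=
  hp _ _ (language_prefix n x) (language_prefix l y).
exists j => //; exists (iter i T z).
have sw : size w = j by rewrite wE size_mkseq.
have sN : N = (n + (j + l))%N.
  by move/(congr1 size): zE; rewrite !size_cat !size_mkseq sw => ->.
have zt t : (t < n + (j + l))%N -> letter z (i + t) =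
    nth (letter z 0) (mkseq (letter x) n ++ w ++ mkseq (letter y) l) t.
  by move=> tN; rewrite zE nth_mkseq ?sN.
split=> t ht; rewrite ?letter_iter.
  by rewrite zt ?ltn_addr// nth_cat size_mkseq ht nth_mkseq.
rewrite zt; last by lia.
rewrite nth_cat size_mkseq ifF; last by lia.
rewrite nth_cat sw ifF; last by lia.
have -> : (n + j + t - n - j = t)%N by lia.
by rewrite nth_mkseq.
Qed.

Variables (f : nat -> S -> R) (nu : probability S R) (P C0 C : R).
Hypotheses (f_gt0 : forall n x, (0 < n)%N -> 0 < f n x) (hC0 : 0 < C0)
  (hgibbs : gibbs_bounds nu f P (fun=> C0)) (C_ge0 : 0 <= C)
  (hadd : additive_up_to f (fun=> C)).

Lemma quasi_bernoulli n l x :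
  expR (- (C + 3 * ln C0)) * (pr nu (cylinder n x) * pr nu (cylinder l (iter n T x)))
    <= pr nu (cylinder (n + l) x).
Proof.
have nu_gt0 := gibbs_cylinder_gt0 f_gt0 hC0 hgibbs.
have lC0 := ln_gibbs_constant_ge0 f_gt0 hC0 hgibbs.
rewrite -ler_ln ?posrE ?mulr_gt0 ?expR_gt0// !lnM ?posrE ?mulr_gt0 ?expR_gt0// expRK.
have c0 : - (C + 3 * ln C0) <= 0 by rewrite oppr_le0 addr_ge0// mulr_ge0.
rewrite -![ln (pr _ _)]/(log_cylinder _ _ _).
have [->|n0] := posnP n; first by rewrite log_cylinder0 add0r gerDr.
have [->|l0] := posnP l; first by rewrite log_cylinder0 addn0 addr0 gerDr.
have := log_cylinder_near f_gt0 hC0 hgibbs x n0.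
have := log_cylinder_increment f_gt0 hC0 hgibbs hadd x n0 l0.
rewrite (addnC l n) !ler_norml => /andP[? _] /andP[_ ?]; lra.
Qed.

Lemma cylinder_lower_bound n : exists2 d : R, 0 < d & forall x, d <= pr nu (cylinder n x).
Proof.
have nu_gt0 := gibbs_cylinder_gt0 f_gt0 hC0 hgibbs.
have [B hB] := log_cylinder_bounded nu n.
exists (expR (- B)) => [|x]; first exact: expR_gt0.
rewrite -ler_ln ?posrE ?expR_gt0// expRK.
by have := hB x; rewrite ler_norml => /andP[].
Qed.

(** Between any two words one may insert a word w of length at most p.  Two uses of
[quasi_bernoulli] bound the measure of the concatenation from below, the factor of
w being at least the least measure of a cylinder of length p. *)
Lemma specification_mixing : weak_specification X ->
  exists p (c : R), 0 < c /\ forall n l x y,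
    c * (pr nu (cylinder n x) * pr nu (cylinder l y)) <=
    \sum_(j < p.+1) pr nu (cylinder n x `&` iter (n + j) T @^-1` cylinder l y).
Proof.
move=> /weak_specification_point[p hp].
have [d d0 hd] := cylinder_lower_bound p.
set c := expR (- (C + 3 * ln C0)).
have c0 : 0 < c by exact: expR_gt0.
exists p, (c * c * d); split; first by rewrite !mulr_gt0.
move=> n l x y; have [j jp [z [zx zy]]] := hp n l x y.
rewrite (bigD1 (Ordinal jp))//=.
apply: (@le_trans _ _ (pr nu (cylinder (n + j + l) z))); last first.
  apply: (@le_trans _ _ (pr nu (cylinder n x `&` iter (n + j) T @^-1` cylinder l y))).
    apply: pr_le; first exact: measurable_cylinder.
      apply: measurableI; first exact: measurable_cylinder.
      by apply: measurable_preimage_iter; exact: measurable_cylinder.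
    move=> a za; split=> t ht.
      by rewrite za ?zx//; lia.
    by rewrite letter_iter za -?letter_iter ?zy//; lia.
  by rewrite lerDl sumr_ge0// => i _; exact: pr_ge0.
apply: le_trans (quasi_bernoulli (n + j) l z); rewrite -/c.
rewrite (eq_cylinder zx) (eq_cylinder zy) -!mulrA ler_pM2l//.
rewrite !mulrA ler_pM2r; last exact: (gibbs_cylinder_gt0 f_gt0 hC0 hgibbs).
apply: le_trans (quasi_bernoulli n j z); rewrite -/c -mulrA ler_pM2l// mulrC.
rewrite ler_pM2l; last exact: (gibbs_cylinder_gt0 f_gt0 hC0 hgibbs).
apply: le_trans (hd (iter n T z)) _.
apply: pr_le; [exact: measurable_cylinder|exact: measurable_cylinder|].
by move=> a za t tj; apply: za; lia.
Qed.

End specification.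

Theorem theorem3p2 (R : realType) (k : nat) (X : subshift k)
  (f : nat -> shift_space X -> R) (nu : probability (shift_space X) R) (P C0 : R)
  (hspec : weak_specification X)
  (hf : continuous_sequence f)
  (hinv : shift_invariant nu)
  (hC0 : 0 < C0)
  (hgibbs : gibbs_bounds nu f P (fun=> C0))
  (hr : forall x : shift_space X, r_lower nu P x = r_upper nu P x) :
  (almost_additive f ->
     [/\ bounded_borel (r_limit nu P),
         (forall mu : probability (shift_space X) R, shift_invariant mu ->
            integral_formula f nu P (r_limit nu P) mu),
         unique_measure (equilibrium_state_seq f) nu,
         unique_measure (equilibrium_state (r_limit nu P)) nu
       & unique_measure (gibbs_measure (r_limit nu P)) nu]) /\
  (weakly_almost_additive f ->
     [/\ bounded_borel (r_limit nu P),
         (forall mu : probability (shift_space X) R, shift_invariant mu ->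
            integral_formula f nu P (r_limit nu P) mu),
         equilibrium_state (r_limit nu P) nu
       & weak_gibbs_measure (r_limit nu P) nu]).
Proof.
have f_gt0 n x : (0 < n)%N -> 0 < f n x by move=> /hf[].
have nu_gt0 := gibbs_cylinder_gt0 f_gt0 hC0 hgibbs.
set r := r_limit nu P.
have err_cvg (C : nat -> R) (a : R) : C n / n%:R @[n --> \oo] --> 0 ->
    (C n + a) / n%:R @[n --> \oo] --> (0 : R).
  move=> Ccvg; rewrite -(addr0 0); under eq_fun do rewrite mulrDl.
  by apply: cvgD => //; exact: gibbs_error_cvg.
(* what both parts share; a sublinear C suffices for it *)
have core (C : nat -> R) : additive_up_to f C -> C n / n%:R @[n --> \oo] --> 0 ->
    [/\ bounded_borel r,
        (forall mu : probability (shift_space X) R, shift_invariant mu ->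
          integral_formula f nu P r mu),
        equilibrium_state r nu
      & gibbs_bounds nu (fun n x => expR (birkhoff_sum r n x)) P
          (fun n => expR (birkhoff_error C0 C n))].
  move=> hadd Ccvg.
  have rb := r_limit_bounded_borel f_gt0 hC0 hgibbs hadd hr.
  have near_f := birkhoff_sum_near f_gt0 hC0 hgibbs hadd hr.
  have near_c := birkhoff_sum_near_cylinder f_gt0 hC0 hgibbs hadd hr.
  have Dcvg := err_cvg _ (3 * ln C0) Ccvg.
  split=> //.
  - move=> mu muinv; split.
      apply: (mean_log_integral_cvg f_gt0 hC0 hgibbs hadd hr muinv _ near_f).
        move=> n n0; apply: measurableT_comp; first exact: measurable_ln.
        by apply: measurable_fun_continuous; case: (hf n n0).
      exact: err_cvg.
    apply: (mean_log_integral_cvg f_gt0 hC0 hgibbs hadd hr muinv _ _ Dcvg).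
      move=> n _; apply: (@measurable_fun_letters _ _ _ n) => x y xy.
      by rewrite (eq_cylinder xy).
    move=> n x n0; have := near_c n x n0.
    by rewrite -[fine _]/(pr nu _) lnM ?posrE ?expR_gt0// expRK.
  - exact: weak_gibbs_equilibrium_state near_c Dcvg.
  - move=> x n n0; have := near_c n x n0; rewrite ler_norml => /andP[h1 h2].
    have c0 := nu_gt0 n x.
    have -> : fine (nu (cylinder n x)) /
        (expR (- (n%:R * P)) * expR (birkhoff_sum r n x)) =
        expR (log_cylinder nu n x + n%:R * P - birkhoff_sum r n x).
      rewrite -expRD -expRN -[fine _]/(pr nu _).
      rewrite -{1}(lnK (x := pr nu (cylinder n x))) ?posrE//.
      by rewrite -expRD; congr expR; rewrite /log_cylinder; ring.
    by rewrite -expRN !ler_expR; apply/andP; split; lra.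
split=> [[C [C_gt0 hadd]]|[C [C_gt0 Ccvg hadd]]].
  have [rb hint req rgibbs] := core _ hadd (gibbs_error_cvg C).
  have near_c : forall n x, (0 < n)%N ->
      `|birkhoff_sum r n x - (log_cylinder nu n x + n%:R * P)| <= C + 3 * ln C0.
    by move=> n x n0; exact: (birkhoff_sum_near_cylinder f_gt0 hC0 hgibbs hadd hr x n0).
  have [p [c [c0 mix]]] := specification_mixing f_gt0 hC0 hgibbs (ltW C_gt0) hadd hspec.
  have erg := mixing_ergodic hinv c0 mix.
  have lim_f mu : shift_invariant mu ->
      limn (mean_log_integral f mu) = (\int[mu]_x (r x)%:E)%E.
    by move=> /hint[h _]; exact/cvg_lim.
  have uniq_r m : equilibrium_state r m -> forall A, measurable A -> m A = nu A.
    exact: (equilibrium_state_unique hinv rb nu_gt0 near_c erg).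
  split=> //.
  - split; first split=> // m minv.
      by rewrite !lim_f//; case: req => _; apply.
    move=> m [minv mmax]; apply: uniq_r; split=> // m' m'inv.
    by rewrite -!lim_f//; exact: mmax.
  - split; last exact: (gibbs_measure_unique hinv nu_gt0 near_c erg).
    split=> //; exists P, (expR (birkhoff_error C0 (fun=> C) 0)).
    by split; [exact: expR_gt0|].
have [rb hint req rgibbs] := core _ hadd Ccvg.
split=> //; split=> //; exists P, (fun n => expR (birkhoff_error C0 C n)).
split=> [n _||//]; first exact: expR_gt0.
under eq_fun do rewrite expRK.
exact: err_cvg.
Qed.
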